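(* Let $n\geq 2$ be an integer and $p(x)=x^{n+1}-(n+1)x$. For any (oriented) knot $K$ in $S^3$ and any knot diagram $D_K$ of $K$, \[ (n-1)(w-O)\ \leq\ g_p^{\min}(K)\ \leq\ g_p^{\max}(K)\ \leq\ (n-1)(w+O), \] where $w$ is the writhe of $D_K$, $O$ is the number of Seifert circles of $D_K$, and $g_p^{\min}(K)$, $g_p^{\max}(K)$ are the minimal and maximal quantum filtration levels of Gornik's version $H_p(K)$ of the Khovanov-Rozansky $sl(n)$-cohomology.
   Context: **Diagrams.** The writhe $w$ of an oriented diagram is the number of positive crossings minus the number of negative crossings. When both strands at a crossing point upward, the crossing is positive if the overstrand goes from bottom left to top right, and negative otherwise. The Seifert circles of the diagram are the disjoint oriented circles obtained by replacing every crossing by its orientation-respecting smoothing (two disjoint parallel arcs). **Cohomology $H_p$ (Khovanov-Rozansky construction with potential $p$).** Fix $n\ge 2$ and $p(x)=x^{n+1}-(n+1)x$. Let $D$ be an oriented link diagram. Place marked points on $D$ away from crossings so that they cut $D$ into pieces, each of which is either a crossing with four distinct endpoints or an embedded crossingless arc with two distinct endpoints. Assign a variable $x_i$ to each marked point. Let $R$ be the polynomial ring over $\mathbb{C}$ in all these variables, graded by $\deg x_i=2$ (the quantum grading). $M\{k\}$ denotes $M$ with grading raised by $k$. A matrix factorization over $R$ with potential $W\in R$ is a pair of maps of free $R$-modules $M^0\to M^1\to M^0$ whose two composites are multiplication by $W$. For $a,b\in R$ whose top-degree parts have degrees summing to $2n+2$, the factorization $(a,b)$ is $R\xrightarrow{a}R\{n+1-\deg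 a\}\xrightarrow{b}R$, with potential $ab$. Tensor products over $R$ add potentials. - An arc from the point $x_j$ to the point $x_i$ is assigned $(\pi_{ij},x_i-x_j)$, where $\pi_{ij}=\frac{p(x_i)-p(x_j)}{x_i-x_j}$. - For a crossing with both strands oriented upward, label the endpoints $x_1$ (top left), $x_2$ (top right), $x_3$ (bottom right), $x_4$ (bottom left). Its two resolutions are $\Gamma_0$ (two arcs $x_4\to x_1$ and $x_3\to x_2$) and $\Gamma_1$ (a wide edge, entered by $x_3,x_4$ and exited by $x_1,x_2$). Set $C(\Gamma_0)=(\pi_{14},x_1-x_4)\otimes(\pi_{23},x_2-x_3)$ and $C(\Gamma_1)=\big((u_1,x_1+x_2-x_3-x_4)\otimes(u_2,x_1x_2-x_3x_4)\big)\{-1\}$. Here $g$ is the two-variable polynomial with $g(x+y,xy)=p(x)+p(y)$, $u_1=\frac{g(x_1+x_2,x_1x_2)-g(x_3+x_4,x_1x_2)}{x_1+x_2-x_3-x_4}$ and $u_2=\frac{g(x_3+x_4,x_1x_2)-g(x_3+x_4,x_3x_4)}{x_1x_2-x_3x_4}$. Explicitly, $C(\Gamma_0)$ is $R\oplus R\{2-2n\}\xrightarrow{P_0}R\{1-n\}\oplus R\{1-n\}\xrightarrow{P_1}R\oplus R\{2-2n\}$ with $P_0=\begin{pmatrix}\pi_{14}&x_2-x_3\\ \pi_{23}&x_4-x_1\end{pmatrix}$, $P_1=\begin{pmatrix}x_1-x_4&x_2-x_3\\ \pi_{23}&-\pi_{14}\end{pmatrix}$, and $C(\Gamma_1)$ is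 $R\{-1\}\oplus R\{3-2n\}\xrightarrow{Q_0}R\{-n\}\oplus R\{2-n\}\xrightarrow{Q_1}R\{-1\}\oplus R\{3-2n\}$ with $Q_0=\begin{pmatrix}u_1&x_1x_2-x_3x_4\\ u_2&x_3+x_4-x_1-x_2\end{pmatrix}$, $Q_1=\begin{pmatrix}x_1+x_2-x_3-x_4&x_1x_2-x_3x_4\\ u_2&-u_1\end{pmatrix}$. - Let $a=\frac{u_2(x_4-x_2)+\pi_{14}-\pi_{23}}{x_1+x_2-x_3-x_4}$, which is a polynomial. The morphism $\chi_0:C(\Gamma_0)\to C(\Gamma_1)$ is given on the two $\mathbb{Z}/2$-components by $\begin{pmatrix}x_4-x_2&0\\ a&1\end{pmatrix}$ and $\begin{pmatrix}x_4&-x_2\\-1&1\end{pmatrix}$. The morphism $\chi_1:C(\Gamma_1)\to C(\Gamma_0)$ is given by $\begin{pmatrix}1&0\\-a&x_4-x_2\end{pmatrix}$ and $\begin{pmatrix}1&x_2\\1&x_4\end{pmatrix}$. - A positive crossing is assigned the complex $0\to C(\Gamma_1)\{n\}\xrightarrow{\chi_1}C(\Gamma_0)\{n-1\}\to0$. A negative crossing is assigned the complex $0\to C(\Gamma_0)\{1-n\}\xrightarrow{\chi_0}C(\Gamma_1)\{-n\}\to 0$. In both cases $C(\Gamma_0)$ is placed in cohomological degree $0$. The tensor product over $R$ (with the usual signs) of the objects of all pieces of $D$ is a complex of matrix factorizations with total potential $0$. It therefore carries the matrix factorization differential $d_{mf}$ (with $d_{mf}^2=0$) and the differential $d_\chi$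 coming from the maps $\chi_0,\chi_1$. Define $H_p(D)=H\big(H(C_p(D),d_{mf}),d_\chi\big)$. **Quantum filtration.** Let $\mathcal{F}^k C_p(D)$ be the set of elements all of whose homogeneous components have quantum degree $\le k$. This increasing filtration induces one on $H(C_p(D),d_{mf})$ (classes having a representative cycle in $\mathcal{F}^k$), and then in the same way on $H_p(D)$. It is denoted $\mathcal{F}^kH_p$ and called the quantum filtration. It is known that $H_p$ with its quantum filtration is, up to isomorphism, a link invariant independent of the diagram and the marking, and that $\dim_{\mathbb{C}}H_p(K)=n$ for a knot $K$. Define \[ g_p^{\max}=\max\{k\mid \mathcal{F}^kH_p/\mathcal{F}^{k-1}H_p\ne0\},\qquad g_p^{\min}=\min\{k\mid \mathcal{F}^kH_p/\mathcal{F}^{k-1}H_p\neq0\}. \] *)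

(* Defs.v *)
From HB Require Import structures.
From mathcomp Require Import all_boot all_order all_algebra.
From mathcomp Require Import classical_sets.
From mathcomp Require Import mpoly.

Set Implicit Arguments.
Unset Strict Implicit.
Unset Printing Implicit Defensive.

Import Order.TTheory GRing.Theory Num.Theory.

Local Open Scope ring_scope.

(* A diagram on the sphere with m marked points is given by the list of the  *)
(* pieces into which the points cut it.  [Arc j i] runs from j to i.         *)
(* [Crossing pos x1 x2 x3 x4] is a crossing, rotated so that both strands    *)
(* point upward:                                                             *)
(*                    x1   x2                                                *)
(*                      \ /        strands x4 -> x2 and x3 -> x1;            *)
(*                       X         pos = true iff x4 -> x2 is the            *)
(*                      / \        overstrand (a positive crossing).         *)
(*                    x4   x3                                                *)

Inductive piece (m : nat) : Type :=
| Arc of 'I_m & 'I_m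
| Crossing of bool & 'I_m & 'I_m & 'I_m & 'I_m.

Section Diagrams.
Variable m : nat.
Implicit Types (pc : piece m) (D : seq (piece m)).

Definition entrances pc : seq 'I_m :=
  match pc with Arc j _ => [:: j] | Crossing _ _ _ x3 x4 => [:: x3; x4] end.

Definition exits pc : seq 'I_m :=
  match pc with Arc _ i => [:: i] | Crossing _ x1 x2 _ _ => [:: x1; x2] end.

Definition strands pc : seq ('I_m * 'I_m) :=
  match pc with
  | Arc j i => [:: (j, i)]
  | Crossing _ x1 x2 x3 x4 => [:: (x4, x2); (x3, x1)]
  end.

Definition smoothing pc : seq ('I_m * 'I_m) :=
  match pc with
  | Arc j i => [:: (j, i)]
  | Crossing _ x1 x2 x3 x4 => [:: (x4, x1); (x3, x2)]
  end.

(* The points (v, false) and (v, true) lie just to the left and just to the  *)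
(* right of the marked point v, with respect to the orientation.  Each pair  *)
(* below consists of two such points which lie in the same corner of pc, so  *)
(* that the regions of the complement of the diagram are the classes that    *)
(* these pairs generate.                                                     *)
Definition corners pc : seq (('I_m * bool) * ('I_m * bool)) :=
  match pc with
  | Arc j i => [:: ((j, false), (i, false)); ((j, true), (i, true))]
  | Crossing _ x1 x2 x3 x4 =>
      [:: ((x4, false), (x1, false)); ((x1, true), (x2, false));
          ((x2, true), (x3, true)); ((x3, false), (x4, true))]
  end.

Definition crossing_sign pc : int :=
  match pc with Arc _ _ => 0 | Crossing pos _ _ _ _ => if pos then 1 else - 1 end.

End Diagrams.

Definition components (T : finType) (E : seq (T * T)) : nat :=
  n_comp [rel u v | ((u, v) \in E) || ((v, u) \in E)] T.

Section DiagramData.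
Variables (m : nat) (D : seq (piece m)).

Definition writhe : int := \sum_(pc <- D) crossing_sign pc.

Definition seifert_circles : nat := components (flatten (map (@smoothing m) D)).

(* The last condition says that the closed oriented surface obtained by      *)
(* filling the regions has Euler characteristic 2: its vertices are the      *)
(* pieces, its edges the marked points and its faces the regions.            *)
Definition knot_diagram : Prop :=
  [/\ all (fun pc => uniq (entrances pc ++ exits pc)) D,
      perm_eq (flatten (map (@entrances m) D)) (enum 'I_m),
      perm_eq (flatten (map (@exits m) D)) (enum 'I_m),
      components (flatten (map (@strands m) D)) = 1%N &
      (size D + components (flatten (map (@corners m) D)) = m + 2)%N].

End DiagramData.

Definition potential (n : nat) (A : pzRingType) (x : A) : A :=
  x ^+ n.+1 - n.+1%:R * x.

(* The quotient f / h when h is nonzero and divides f, see exquoK; the value *)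
(* 0 when h does not divide f never matters below.                           *)
Definition exquo (A : idomainType) (f h : A) : A :=
  xget 0 [set q | q * h = f]%classic.

Lemma exquoK (A : idomainType) (q h : A) : h != 0 -> exquo (q * h) h = q.
Proof.
move=> h0; rewrite /exquo.
case: xgetP => [q' _ /= /(mulIf h0) -> // | /(_ q)]; by case.
Qed.

Section Polynomials.
Variables (F : fieldType) (n m : nat).
Local Notation A := {mpoly F[m]}.

(* This g is unique since x + y and xy are algebraically independent, and it *)
(* exists since p(x) + p(y) is symmetric.                                    *)
Definition gpoly : {mpoly F[2]} :=
  let x : {mpoly F[2]} := 'X_(inord 0) in
  let y : {mpoly F[2]} := 'X_(inord 1) in
  xget 0 [set g : {mpoly F[2]} |
    g \mPo [tuple x + y; x * y] = potential n x + potential n y]%classic.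

Definition geval (s q : A) : A := gpoly \mPo [tuple s; q].

Definition pi_ (i j : 'I_m) : A :=
  exquo (potential n 'X_i - potential n 'X_j) ('X_i - 'X_j).

Section Crossing.
Variables i1 i2 i3 i4 : 'I_m.
Let x1 : A := 'X_i1.
Let x2 : A := 'X_i2.
Let x3 : A := 'X_i3.
Let x4 : A := 'X_i4.

Definition u1_ : A :=
  exquo (geval (x1 + x2) (x1 * x2) - geval (x3 + x4) (x1 * x2))
        (x1 + x2 - x3 - x4).

Definition u2_ : A :=
  exquo (geval (x3 + x4) (x1 * x2) - geval (x3 + x4) (x3 * x4))
        (x1 * x2 - x3 * x4).

Definition a_ : A :=
  exquo (u2_ * (x4 - x2) + pi_ i1 i4 - pi_ i2 i3) (x1 + x2 - x3 - x4).

Definition mx22 (a b c d : A) : 'M[A]_2 :=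
  \matrix_(i, j) (if i == 0 then (if j == 0 then a else b)
                            else (if j == 0 then c else d)).

(* The boolean is the Z/2-degree of the source; matrices act on columns. *)
Definition Pmx (e : bool) : 'M[A]_2 :=
  if ~~ e then mx22 (pi_ i1 i4) (x2 - x3)
                    (pi_ i2 i3) (x4 - x1)
          else mx22 (x1 - x4)   (x2 - x3)
                    (pi_ i2 i3) (- pi_ i1 i4).

Definition Qmx (e : bool) : 'M[A]_2 :=
  if ~~ e then mx22 u1_ (x1 * x2 - x3 * x4)
                    u2_ (x3 + x4 - x1 - x2)
          else mx22 (x1 + x2 - x3 - x4) (x1 * x2 - x3 * x4)
                    u2_                 (- u1_).

Definition chi0mx (e : bool) : 'M[A]_2 :=
  if ~~ e then mx22 (x4 - x2) 0
                    a_        1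
          else mx22 x4    (- x2)
                    (- 1) 1.

Definition chi1mx (e : bool) : 'M[A]_2 :=
  if ~~ e then mx22 1      0
                    (- a_) (x4 - x2)
          else mx22 1 x2
                    1 x4.

End Crossing.
End Polynomials.

(* A complex of matrix factorizations of free modules of finite rank is      *)
(* given by a homogeneous basis; qdeg, parity and hdeg are the quantum, Z/2- *)
(* and cohomological degrees of the basis elements, and dmf t s, dchi t s    *)
(* are the coefficients at t of the images of s.                             *)

Record mfcomplex (A : Type) : Type := MFComplex {
  basis : finType;
  qdeg : basis -> int;
  parity : basis -> bool;
  hdeg : basis -> int;
  dmf : basis -> basis -> A;
  dchi : basis -> basis -> A
}.

Section Tensor.
Variable A : pzRingType.

Definition unit_complex : mfcomplex A :=
  @MFComplex A unit (fun=> 0) (fun=> false) (fun=> 0)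
    (fun _ _ => 0) (fun _ _ => 0).

Definition tensor (C1 C2 : mfcomplex A) : mfcomplex A :=
  @MFComplex A (basis C1 * basis C2)%type
    (fun b => qdeg b.1 + qdeg b.2)
    (fun b => parity b.1 (+) parity b.2)
    (fun b => hdeg b.1 + hdeg b.2)
    (fun t s => dmf t.1 s.1 * (t.2 == s.2)%:R
              + (-1) ^+ parity s.1 * (t.1 == s.1)%:R * dmf t.2 s.2)
    (fun t s => dchi t.1 s.1 * (t.2 == s.2)%:R
              + (-1) ^+ absz (hdeg s.1) * (t.1 == s.1)%:R * dchi t.2 s.2).

Definition chain (C : mfcomplex A) : zmodType := {ffun basis C -> A}.

Definition apply_mx (C : mfcomplex A) (d : basis C -> basis C -> A)
  (x : chain C) : chain C :=
  [ffun t => \sum_s d t s * (x : {ffun basis C -> A}) s].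

End Tensor.

Section PieceComplex.
Variables (F : fieldType) (n m : nat).
Local Notation A := {mpoly F[m]}.

Definition arc_complex (j i : 'I_m) : mfcomplex A :=
  @MFComplex A bool
    (fun e => if e then 1 - n%:Z else 0)
    id
    (fun=> 0)
    (fun t s => match s, t with
                | false, true => pi_ F n i j
                | true, false => 'X_i - 'X_j
                | _, _ => 0
                end)
    (fun _ _ => 0).

(* The basis element (G, e, k) is the k-th generator in Z/2-degree e of      *)
(* C(Gamma_1) if G, and of C(Gamma_0) otherwise.                             *)
Definition crossing_complex (pos : bool) (x1 x2 x3 x4 : 'I_m) : mfcomplex A :=
  @MFComplex A (bool * bool * 'I_2)%type
    (fun b => let: (G, e, k) := b in
       (if ~~ G then (if ~~ e then (if k == 0 then 0 else 2 - n%:Z *+ 2)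
                              else 1 - n%:Z)
                else (if ~~ e then (if k == 0 then - 1 else 3 - n%:Z *+ 2)
                              else (if k == 0 then - n%:Z else 2 - n%:Z)))
       + (if pos then (if G then n%:Z else n%:Z - 1)
                 else (if G then - n%:Z else 1 - n%:Z)))
    (fun b => b.1.2)
    (fun b => if b.1.1 then (if pos then - 1 else 1) else 0)
    (fun t s => let: (G', e', k') := t in let: (G, e, k) := s in
       if (G' == G) && (e' != e) then
         (if G then Qmx F n x1 x2 x3 x4 e else Pmx F n x1 x2 x3 x4 e) k' k
       else 0)
    (fun t s => let: (G', e', k') := t in let: (G, e, k) := s in
       if [&& G == pos, G' != G & e' == e] then
         (if pos then chi1mx F n x1 x2 x3 x4 e
                 else chi0mx F n x1 x2 x3 x4 e) k' k
       else 0).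

Definition piece_complex (pc : piece m) : mfcomplex A :=
  match pc with
  | Arc j i => arc_complex j i
  | Crossing pos x1 x2 x3 x4 => crossing_complex pos x1 x2 x3 x4
  end.

Definition diagram_complex (D : seq (piece m)) : mfcomplex A :=
  foldr (fun pc C => tensor (piece_complex pc) C) (unit_complex A) D.

(* The variables have quantum degree 2. *)
Definition chain_filtration (C : mfcomplex A) (k : int) (x : chain C) : Prop :=
  forall b : basis C, forall mon,
    mon \in msupp ((x : {ffun basis C -> A}) b) ->
    qdeg b + (mdeg mon)%:Z *+ 2 <= k.

End PieceComplex.

(* The record presents the quotient cyc / bdr of subgroups bdr <= cyc of V;  *)
(* fil k is the preimage in cyc of the k-th step of its filtration.          *)

Record fsubquo (V : zmodType) : Type := FSubquo {
  cyc : V -> Prop;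
  bdr : V -> Prop;
  fil : int -> V -> Prop
}.

Section Homology.
Variable V : zmodType.
Implicit Type S : fsubquo V.

(* The homology of the endomorphism that d induces on S; its k-th step       *)
(* consists of the classes represented by a cycle in the k-th step of S.     *)
Definition homology (d : V -> V) S : fsubquo V :=
  let Z x := cyc S x /\ bdr S (d x) in
  let B x := exists w b, [/\ cyc S w, bdr S b & x = d w + b] in
  FSubquo Z B (fun k x => Z x /\ exists y, [/\ Z y, fil S k y & B (x - y)]).

Definition graded_nonzero S (k : int) : Prop :=
  exists x, fil S k x /\ ~ fil S (k - 1) x.

End Homology.

Section Hp.
Variables (F : fieldType) (n m : nat) (D : seq (piece m)).
Let C := diagram_complex F n D.

Definition chains : fsubquo (chain C) :=
  FSubquo (fun=> True) (fun x => x = 0) (@chain_filtration F m C).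

Definition Hp : fsubquo (chain C) :=
  homology (apply_mx (@dchi _ C)) (homology (apply_mx (@dmf _ C)) chains).

Definition is_gmax (k : int) : Prop :=
  graded_nonzero Hp k /\ forall k', graded_nonzero Hp k' -> k' <= k.

Definition is_gmin (k : int) : Prop :=
  graded_nonzero Hp k /\ forall k', graded_nonzero Hp k' -> k <= k'.

End Hp.

(* Main.v *)
Require Import Defs.
From HB Require Import structures.
From mathcomp Require Import all_boot all_order all_algebra.
From mathcomp Require Import separable cyclotomic boolp.
From mathcomp Require classical_sets.
From mathcomp Require Import mpoly.
From mathcomp Require Import reals complex.
From mathcomp Require Import ring zify.

Set Implicit Arguments.
Unset Strict Implicit.
Unset Printing Implicit Defensive.

Import Order.TTheory GRing.Theory Num.Theory.

Local Open Scope ring_scope.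

Local Notation gens := Defs.basis.

(** A marked point carries a variable x_k, and x_k ^ n = 1 holds in the homology
    of every resolution: the derivative of a factorized potential a1 b1 + a2 b2
    lies in the ideal of its entries, which act by zero, and p'(x) is
    (n + 1) (x ^ n - 1) ([annihilator_unity]).  So chains split, up to homotopy,
    under the idempotents of the states, the maps psi from the marked points to
    the n-th roots of unity, and the two differentials respect this splitting.

    A state that is not constant along some strand contributes nothing to the
    homology ([nonconstant_state]): either x4 - x2 is invertible at a crossing,
    where it is null-homotopic for the second differential because chi_0 and chi_1
    are inverse to each other up to this factor, or each factorization of the
    piece has an invertible entry.  For a knot the constant states remain, and in
    these every resolution with a wide edge is acyclic, since u_2 takes the value
    - p'' there ([u2_diag], [constant_state]).  Therefore the whole homology comes
    from the oriented resolution, the Koszul factorization of the Seifert circles,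
    on which the second differential has no component.

    In that factorization an edge between two different classes of points
    eliminates a variable, while an edge that closes a circle becomes the
    factor (p'(x), 0).  A cycle at the constant state c is thus a boundary as
    soon as one of its coordinates vanishes at c, namely the coordinate in which
    the closing edges, and no others, contribute their odd generator
    ([cycle_boundary]); and there is a cycle y of filtration degree (1 - n) O whose
    coordinate is 1 ([top_cycle]), O being the number of Seifert circles.

    Both bounds follow, after the shift by (n - 1) w.  A class is a combination
    of the multiples of y by idempotents of degree 2 (n - 1) O, which gives
    the upper bound ([represented]).  A chain of filtration degree
    less than (1 - n) O has coordinate zero for reasons of degree, so its class
    is zero ([low_filtration]).  Finally differentials vanish at the point c, so
    the multiples of y survive and the homology is nonzero ([nonzero_class]). *)

(** * Factorizations of the potential *)

(** The quotient (p(x) - p(y)) / (x - y), written out so that it makes sense at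
    every pair of ring elements and commutes with ring morphisms.  On the
    diagonal it is p'(x). *)
Definition pquot (A : pzRingType) (n : nat) (x y : A) : A :=
  \sum_(k < n.+1) x ^+ (n - k) * y ^+ k - n.+1%:R.

Lemma pquotP (A : comPzRingType) n (x y : A) :
  potential n x - potential n y = pquot n x y * (x - y).
Proof.
have := subrXX x y n.+1; rewrite /pquot /potential /=.
move: (x ^+ n.+1) (y ^+ n.+1) => a b.
set S := \sum_(_ < _) _ => H.
transitivity ((a - b) - n.+1%:R * (x - y)); first by ring.
by rewrite H; ring.
Qed.

Lemma pquot_diag (A : comPzRingType) n (x : A) :
  pquot n x x = n.+1%:R * (x ^+ n - 1).
Proof.
rewrite /pquot (eq_bigr (fun=> x ^+ n)).
  by rewrite sumr_const card_ord mulrBr mulr1 mulr_natl.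
by move=> k _; rewrite -exprD subnK // -ltnS.
Qed.

Lemma rmorph_pquot (A B : pzRingType) (f : {rmorphism A -> B}) n x y :
  f (pquot n x y) = pquot n (f x) (f y).
Proof.
rewrite /pquot rmorphB rmorph_nat rmorph_sum; congr (_ - _).
by apply: eq_bigr => k _; rewrite rmorphM !rmorphXn.
Qed.

Lemma rmorph_potential (A B : pzRingType) (f : {rmorphism A -> B}) n x :
  f (potential n x) = potential n (f x).
Proof. by rewrite /potential rmorphB rmorphM rmorph_nat rmorphXn. Qed.

Lemma exquo_spec (A : idomainType) (f h : A) :
  (exists q, q * h = f) -> exquo f h * h = f.
Proof. by move=> H; exact: (classical_sets.xgetPex 0 H). Qed.

Section Congruence.
Variables (B : comNzRingType) (J : B -> Prop).

(** Ideals are predicates, so that principal ideals and annihilators of homology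
    classes are treated alike. *)
Definition ideal_pred :=
  [/\ J 0, forall x y, J x -> J y -> J (x + y) & forall c x, J x -> J (c * x)].

Hypothesis JI : ideal_pred.

Lemma mmap_congr (F : fieldType) m (f : {rmorphism F -> B}) (h h' : 'I_m -> B) :
  (forall i, J (h i - h' i)) -> forall p, J (mmap f h p - mmap f h' p).
Proof.
have [J0 JD JM] := JI.
have JMr x c : J x -> J (x * c) by rewrite mulrC; apply: (JM).
move=> Jh; elim/mpolyind => [|c mon p _ _ IH]; first by rewrite !mmap0 subr0.
rewrite !mmapD !mmapZ !mmapX opprD addrACA; apply: (JD) => //.
rewrite -mulrBr; apply: (JM); rewrite /mmap1.
apply: (big_ind2 (fun x y => J (x - y))) => [|x x' y y' Jx Jy|i _].
- by rewrite subrr.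
- rewrite (_ : _ - _ = (x - x') * y + x' * (y - y')); last by ring.
  by apply: (JD); [apply: (JMr) | apply: (JM)].
- by rewrite subrXX; apply: (JMr).
Qed.

End Congruence.

Definition multiple (B : comNzRingType) (b x : B) := exists q, x = q * b.

Lemma multiple_ideal (B : comNzRingType) (b : B) : ideal_pred (multiple b).
Proof.
split=> [|x y [q ->] [q' ->]|c x [q ->]]; first by exists 0; rewrite mul0r.
  by exists (q + q'); rewrite mulrDl.
by exists (c * q); rewrite mulrA.
Qed.

Section Substitution.
Variables (F : fieldType) (m : nat).
Local Notation A := {mpoly F[m]}.

Definition subst (h : 'I_m -> A) : A -> A := mmap (@mpolyC m F) h.

HB.instance Definition _ h := GRing.RMorphism.on (subst h).

Lemma substX h i : subst h 'X_i = h i.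
Proof. by rewrite /subst mmapX mmap1U. Qed.

Lemma substC h c : subst h c%:MP = c%:MP.
Proof. by rewrite /subst mmapC. Qed.

Lemma subst_id p : subst (fun i => 'X_i) p = p.
Proof. by rewrite -[RHS]comp_mpoly_id; apply: eq_bigr => mon _;
  congr (_ * _); apply: mmap1_eq => i; rewrite tnth_mktuple. Qed.

Lemma eq_subst h h' : h =1 h' -> subst h =1 subst h'.
Proof. by move=> e p; apply: eq_bigr => mon _; congr (_ * _); apply: mmap1_eq. Qed.

Lemma mmap_comp (B : comNzRingType) (f : {rmorphism F -> B}) (g : 'I_m -> B) k
    (h : 'I_k -> A) (p : {mpoly F[k]}) :
  mmap f g (mmap (@mpolyC m F) h p) = mmap f (fun i => mmap f g (h i)) p.
Proof.
rewrite {2}/mmap rmorph_sum /=; apply: eq_bigr => mon _.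
rewrite rmorphM /= mmapC; congr (_ * _).
by rewrite /mmap1 rmorph_prod; apply: eq_bigr => i _; rewrite rmorphXn.
Qed.

Lemma subst_comp h h' p : subst h (subst h' p) = subst (fun i => subst h (h' i)) p.
Proof. exact: mmap_comp. Qed.

Lemma subst_const (c : 'I_m -> F) p : subst (fun i => (c i)%:MP) p = (p.@[c])%:MP.
Proof.
elim/mpolyind: p => [|a mon p _ _ IH]; first by rewrite meval0 rmorph0 mpolyC0.
rewrite rmorphD /= IH mevalD mpolyCD; congr (_ + _).
rewrite mevalZ mevalX mpolyCM rmorph_prod /subst mmapZ mmapX; congr (_ * _).
by apply: eq_bigr => i _; rewrite rmorphXn.
Qed.

(** Taylor expansion at c: the ideal of the x_i - c_i contains p - p(c). *)
Lemma ideal_eval (J : A -> Prop) (c : 'I_m -> F) e p : ideal_pred J ->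
  (forall i, J (('X_i - (c i)%:MP) * e)) -> J ((p - (p.@[c])%:MP) * e).
Proof.
move=> [J0 JD JM] H.
have JI : ideal_pred (fun x => J (x * e)).
  split=> [|x y Jx Jy|a x Jx]; rewrite ?mul0r ?mulrDl -?mulrA //; first exact: (JD).
  exact: (JM).
by have := @mmap_congr _ _ JI F m (@mpolyC m F) _ _ H p; rewrite -!/(subst _ _)
  subst_id subst_const.
Qed.

Lemma subst_divides (j : 'I_m) (t : A) p :
  let h := fun k => if k == j then t else 'X_k in
  exists q, p - subst h p = (t - 'X_j) * q.
Proof.
move=> h.
have [|q Hq] := @mmap_congr _ _ (multiple_ideal (t - 'X_j)) F m (@mpolyC m F)
   (fun i => 'X_i) h _ p.
  move=> i; rewrite /h; case: eqP => [->|_].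
    by exists (-1); rewrite mulN1r opprB.
  by exists 0; rewrite mul0r subrr.
by exists q; rewrite mulrC -Hq -!/(subst _ _) subst_id.
Qed.

End Substitution.

Section LocalFactorizations.
Variables (F : fieldType) (n m : nat).
Local Notation A := {mpoly F[m]}.
Local Notation X i := ('X_i : A).

Lemma X_neq (i j : 'I_m) : i != j -> X i - X j != 0.
Proof.
move=> ij; apply/eqP => /(congr1 (meval (fun k => (k == i)%:R))).
rewrite mevalB !mevalXU meval0 eqxx eq_sym (negPf ij) subr0.
by move/eqP; rewrite oner_eq0.
Qed.

Lemma pi_E (i j : 'I_m) : i != j -> pi_ F n i j = pquot n (X i) (X j).
Proof. by move=> ij; rewrite /pi_ pquotP exquoK // X_neq. Qed.

(** Newton's recursion x^(k+2) + y^(k+2) =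
    (x + y) (x^(k+1) + y^(k+1)) - x y (x^k + y^k); it starts from two consecutive
    values, hence the pair. *)
Lemma power_sums k : exists g g' : {mpoly F[2]},
  let x : {mpoly F[2]} := 'X_(inord 0) in
  let y : {mpoly F[2]} := 'X_(inord 1) in
  let t := [tuple x + y; x * y] in
  g \mPo t = x ^+ k + y ^+ k /\ g' \mPo t = x ^+ k.+1 + y ^+ k.+1.
Proof.
elim: k => [|k [g [g' [Hg Hg']]]].
  exists 2%:R, 'X_0 => x y t; rewrite rmorph_nat comp_mpolyXU /= !expr0 !expr1.
  by split.
exists g', ('X_0 * g' - 'X_1 * g) => x y t; split=> //.
rewrite rmorphB !rmorphM /= Hg Hg' !comp_mpolyXU /= !exprS -/x -/y.
by move: x y {Hg Hg' t} => x y; ring.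
Qed.

Lemma gpolyP : let x : {mpoly F[2]} := 'X_(inord 0) in
  let y : {mpoly F[2]} := 'X_(inord 1) in
  gpoly F n \mPo [tuple x + y; x * y] = potential n x + potential n y.
Proof.
move=> x y; pose P (g : {mpoly F[2]}) : Prop :=
  g \mPo [tuple x + y; x * y] = potential n x + potential n y.
apply: (@classical_sets.xgetPex _ 0 P); rewrite {}/P {}/x {}/y.
have [_ [g [_ Hg]]] := power_sums n.
exists (g - n.+1%:R * 'X_0) => /=.
rewrite rmorphB rmorphM rmorph_nat /= Hg comp_mpolyXU /= /potential; ring.
Qed.

Lemma gevalE (s q : A) :
  geval n s q = mmap (@mpolyC m F) (tnth [tuple s; q]) (gpoly F n).
Proof. by []. Qed.

Lemma geval_sum (x y : A) :
  geval n (x + y) (x * y) = potential n x + potential n y.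
Proof.
pose h (i : 'I_2) := if i == 0 then x else y.
have := congr1 (mmap (@mpolyC m F) h) gpolyP.
rewrite /= mmap_comp rmorphD !rmorph_potential /= !mmapX !mmap1U.
rewrite /h -!val_eqE /= !inordK //= => <-.
rewrite gevalE; apply: eq_bigr => mon _; congr (_ * _); apply: mmap1_eq => i.
case: i => [[|[|//]] ?]; rewrite !(tnth_nth 0) /= ?rmorphD ?rmorphM /=
  !mmapX !mmap1U -!val_eqE /= !inordK //=.
Qed.

Lemma geval_diffl (s s' q : A) : multiple (s - s') (geval n s q - geval n s' q).
Proof.
rewrite !gevalE; apply: mmap_congr; first exact: multiple_ideal.
move=> [[|[|//]] ?]; rewrite !(tnth_nth 0) /=; first by exists 1; rewrite mul1r.
by exists 0; rewrite subrr mul0r.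
Qed.

Lemma geval_diffr (s q q' : A) : multiple (q - q') (geval n s q - geval n s q').
Proof.
rewrite !gevalE; apply: mmap_congr; first exact: multiple_ideal.
move=> [[|[|//]] ?]; rewrite !(tnth_nth 0) /=; last by exists 1; rewrite mul1r.
by exists 0; rewrite subrr mul0r.
Qed.

Section Crossing.
Variables i1 i2 i3 i4 : 'I_m.
Local Notation x1 := (X i1).
Local Notation x2 := (X i2).
Local Notation x3 := (X i3).
Local Notation x4 := (X i4).
Local Notation p := (potential n).
Local Notation u1 := (u1_ F n i1 i2 i3 i4).
Local Notation u2 := (u2_ F n i1 i2 i3 i4).

Lemma u12P : u1 * (x1 + x2 - x3 - x4) + u2 * (x1 * x2 - x3 * x4) =
  p x1 + p x2 - p x3 - p x4.
Proof.
rewrite !exquo_spec; first by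
  rewrite !geval_sum; move: (geval _ _ _) (p x1) (p x2) (p x3) (p x4) => *; ring.
  by have [q ->] := geval_diffr (x3 + x4) (x1 * x2) (x3 * x4); exists q.
have [q ->] := geval_diffl (x1 + x2) (x3 + x4) (x1 * x2).
by exists q; rewrite -addrA opprD.
Qed.

Hypothesis U : uniq [:: i1; i2; i3; i4].

Let ne : [/\ i1 != i2, i1 != i3 & i1 != i4] /\ [/\ i2 != i3, i2 != i4 & i3 != i4].
Proof.
by move: U; rewrite /= !inE !negb_or => /and4P[/and3P[? ? ?] /andP[? ?] ? _].
Qed.

Lemma pi1423P : pi_ F n i1 i4 * (x1 - x4) + pi_ F n i2 i3 * (x2 - x3) =
  p x1 + p x2 - p x3 - p x4.
Proof. by have [[? ? ?] [? ? ?]] := ne; rewrite !pi_E // -!pquotP;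
  move: (p x1) (p x2) (p x3) (p x4) => *; ring. Qed.

Lemma ds_neq0 : x1 + x2 - x3 - x4 != 0.
Proof.
have [[n12 n13 n14] _] := ne.
apply/eqP => /(congr1 (meval (fun k => (k == i1)%:R))).
rewrite !mevalB mevalD !mevalXU meval0 eqxx ![_ == i1]eq_sym.
rewrite (negPf n12) (negPf n13) (negPf n14) addr0 !subr0.
by move/eqP; rewrite oner_eq0.
Qed.

(** On the hyperplane x1 + x2 = x3 + x4 one has x2 - x3 = - (x1 - x4) and
    x1 x2 - x3 x4 = (x1 - x4) (x2 - x4).  Comparing the two factorizations of
    p(x1) + p(x2) - p(x3) - p(x4) there shows that x1 - x4 times the numerator of a
    vanishes, and the coordinate ring of the hyperplane is a domain. *)
Lemma a_P : a_ F n i1 i2 i3 i4 * (x1 + x2 - x3 - x4) =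
  u2 * (x4 - x2) + pi_ F n i1 i4 - pi_ F n i2 i3.
Proof.
have [[n12 n13 n14] [n23 n24 n34]] := ne.
apply: exquo_spec.
pose t := x3 + x4 - x2; pose h := fun k => if k == i1 then t else X k.
set f := u2 * (x4 - x2) + _ - _; have [q Hq] := subst_divides i1 t f.
suff f0 : subst h f = 0.
  exists (- q); move: Hq; rewrite -/h f0 subr0 => ->; rewrite /t; ring.
have h1 : subst h x1 = t by rewrite substX /h eqxx.
have hk k : k != i1 -> subst h (X k) = X k by rewrite substX /h => /negPf->.
have [h2 h3 h4] : [/\ subst h x2 = x2, subst h x3 = x3 & subst h x4 = x4].
  by split; apply: hk; rewrite eq_sym.
have := congr1 (subst h) pi1423P; rewrite -u12P /f !rmorphB !rmorphD !rmorphM /=.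
rewrite !rmorphB rmorphD !rmorphM /= h1 h2 h3 h4 => H.
apply: (mulIf (x := t - x4)).
  have -> : t - x4 = x3 - x2 by rewrite /t; ring.
  by rewrite X_neq // eq_sym.
rewrite mul0r; move: H; set P := subst h (pi_ _ _ _ _); set Q := subst h (pi_ _ _ _ _).
set V := subst h u2; set U' := subst h u1.
clearbody P Q V U'; rewrite /t => H.
transitivity ((P * (x3 + x4 - x2 - x4) + Q * (x2 - x3)) -
  (U' * (x3 + x4 - x2 + x2 - x3 - x4) + V * ((x3 + x4 - x2) * x2 - x3 * x4))); first by ring.
by rewrite H subrr.
Qed.

(** The equation of [a_P] restricts to the line (c, c + t, c + t, c) as
    t u2 = p'(c) - p'(c + t), whence u2 = - p''(c) at t = 0. *)
Lemma u2_diag (c : F) : c ^+ n = 1 ->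
  u2.@[fun=> c] = - (n.+1%:R * (n%:R * c ^+ n.-1)).
Proof.
move=> cn; have [[n12 n13 n14] [n23 n24 n34]] := ne.
pose ct := c%:P + 'X : {poly F}.
pose h k := if (k == i1) || (k == i4) then c%:P else ct.
pose th := mmap (@polyC F) h.
have thX k : th (X k) = h k by rewrite /th mmapX mmap1U.
have h1 : h i1 = c%:P by rewrite /h eqxx.
have h4 : h i4 = c%:P by rewrite /h eqxx orbT.
have h2 : h i2 = ct by rewrite /h eq_sym (negPf n12) (negPf n24).
have h3 : h i3 = ct by rewrite /h eq_sym (negPf n13) (negPf n34).
have : th (a_ F n i1 i2 i3 i4) * th (x1 + x2 - x3 - x4) = th u2 * th (x4 - x2) +
    th (pquot n x1 x4) - th (pquot n x2 x3).
  by rewrite /th -!rmorphM -rmorphD -rmorphB a_P !pi_E.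
rewrite /th !rmorph_pquot.
rewrite !rmorphB rmorphD /= -/th !thX h1 h2 h3 h4 !pquot_diag.
have -> : (c%:P + ct - ct - c%:P : {poly F}) = 0 by ring.
have -> : c%:P ^+ n = 1 :> {poly F} by rewrite -polyC_exp cn.
rewrite mulr0 subrr mulr0 addr0.
have -> : ct ^+ n - 1 = ct ^+ n - c%:P ^+ n :> {poly F} by rewrite -polyC_exp cn.
rewrite subrXX; set S := \sum_(_ < _) _.
have -> : (c%:P - ct : {poly F}) = - 'X by rewrite /ct; ring.
have -> : (ct - c%:P : {poly F}) = 'X by rewrite /ct; ring.
move=> H.
have {}H : th u2 = - (n.+1%:R * S).
  apply: (mulIf (negbT (polyX_eq0 F))).
  transitivity (th u2 * 'X + (th u2 * (- 'X) - n.+1%:R * ('X * S))).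
    by rewrite -H addr0.
  ring.
have -> : u2.@[fun=> c] = (th u2).[0].
  rewrite /meval /th /mmap horner_sum; apply: eq_bigr => mon _.
  rewrite hornerCM; congr (_ * _); rewrite /mmap1 horner_prod.
  apply: eq_bigr => i _; rewrite horner_exp; congr (_ ^+ _).
  by rewrite /h /ct; case: ifP => _; rewrite !hornerE.
rewrite H hornerN hornerM hornerMn hornerC; congr (- (_ * _)).
rewrite horner_sum (eq_bigr (fun=> c ^+ n.-1)).
  by rewrite sumr_const card_ord mulr_natl.
move=> i _; rewrite hornerM !horner_exp !hornerE -exprD.
by congr (_ ^+ _); have := ltn_ord i; lia.
Qed.

End Crossing.
End LocalFactorizations.

(** * Operators on tensor products *)

Section Kernels.
Variable A : comNzRingType.

Definition kmul (T : finType) (M N : T -> T -> A) t s := \sum_r M t r * N r s.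

(** Both differentials of a tensor product have this shape, and so do the
    homotopies that come from one of the two factors. *)
Definition tensor_kernel (P C : finType) (M : P -> P -> A) (eps : P -> A)
    (N : C -> C -> A) (t s : P * C) : A :=
  M t.1 s.1 * (t.2 == s.2)%:R + eps s.1 * (t.1 == s.1)%:R * N t.2 s.2.

Lemma sum_deltal (T : finType) (f : T -> A) t : \sum_r (t == r)%:R * f r = f t.
Proof.
rewrite (bigD1 t) //= eqxx mul1r big1 ?addr0 // => r /negPf.
by rewrite eq_sym => ->; rewrite mul0r.
Qed.

Lemma sum_deltar (T : finType) (f : T -> A) s : \sum_r f r * (r == s)%:R = f s.
Proof.
rewrite (bigD1 s) //= eqxx mulr1 big1 ?addr0 // => r /negPf ->.
by rewrite mulr0.
Qed.

Lemma tensor_kernel_mul (P C : finType) (M M' : P -> P -> A) eps eps' (N N' : C -> C -> A) t s :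
  kmul (tensor_kernel M eps N) (tensor_kernel M' eps' N') t s =
    kmul M M' t.1 s.1 * (t.2 == s.2)%:R
    + eps' s.1 * M t.1 s.1 * N' t.2 s.2 + eps t.1 * M' t.1 s.1 * N t.2 s.2
    + eps s.1 * eps' s.1 * (t.1 == s.1)%:R * kmul N N' t.2 s.2.
Proof.
case: t s => [t1 t2] [s1 s2]; rewrite /kmul /tensor_kernel /=.
rewrite -(pair_bigA _ (fun r1 r2 =>
  (M t1 r1 * (t2 == r2)%:R + eps r1 * (t1 == r1)%:R * N t2 r2) *
  (M' r1 s1 * (r2 == s2)%:R + eps' s1 * (r1 == s1)%:R * N' r2 s2))) /=.
under eq_bigr => r1 _.
  rewrite (eq_bigr (fun r2 =>
     (M t1 r1 * M' r1 s1) * ((t2 == r2)%:R * (r2 == s2)%:R) +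
     (M t1 r1 * eps' s1 * (r1 == s1)%:R) * ((t2 == r2)%:R * N' r2 s2) +
     (eps r1 * (t1 == r1)%:R * M' r1 s1) * (N t2 r2 * (r2 == s2)%:R) +
     (eps r1 * (t1 == r1)%:R * eps' s1 * (r1 == s1)%:R) * (N t2 r2 * N' r2 s2)));
    last by move=> r2 _; ring.
  rewrite !big_split /= -!mulr_sumr sum_deltar !sum_deltal sum_deltar.
  over.
rewrite !big_split /= -!mulr_suml; congr (_ + _ + _ + _).
- congr (_ * _); rewrite sum_deltar mulrC; done.
- congr (_ * _); transitivity (\sum_r (t1 == r)%:R * (eps r * M' r s1)).
    by apply: eq_bigr => r _; ring.
  by rewrite sum_deltal.
- congr (_ * _); transitivity (\sum_r (t1 == r)%:R * (eps r * eps' s1 * (r == s1)%:R)).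
    by apply: eq_bigr => r _; ring.
  rewrite sum_deltal; case: eqP => [->|]; rewrite ?mulr0 //.
Qed.

Lemma kmul0l (T : finType) (N : T -> T -> A) t s : kmul (fun _ _ => 0) N t s = 0.
Proof. by rewrite /kmul big1 // => r _; rewrite mul0r. Qed.

Lemma kmul0r (T : finType) (N : T -> T -> A) t s : kmul N (fun _ _ => 0) t s = 0.
Proof. by rewrite /kmul big1 // => r _; rewrite mulr0. Qed.

Section Action.
Variable T : finType.
Implicit Types (z : {ffun T -> A}) (d : T -> T -> A) (w : T -> A).

Definition kapp d z : {ffun T -> A} := [ffun t => \sum_s d t s * z s].
Definition dg w z : {ffun T -> A} := [ffun t => w t * z t].
Definition sc f z := dg (fun=> f) z.
Definition msk (q : T -> bool) z := dg (fun t => (q t)%:R) z.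

Lemma kappD d z z' : kapp d (z + z') = kapp d z + kapp d z'.
Proof.
apply/ffunP => t; rewrite !ffunE -big_split; apply: eq_bigr => s _.
by rewrite ffunE mulrDr.
Qed.

Lemma kappN d z : kapp d (- z) = - kapp d z.
Proof.
apply/ffunP => t; rewrite !ffunE -sumrN; apply: eq_bigr => s _.
by rewrite ffunE mulrN.
Qed.

Lemma kappB d z z' : kapp d (z - z') = kapp d z - kapp d z'.
Proof. by rewrite kappD kappN. Qed.

Lemma kapp0 d : kapp d 0 = 0.
Proof. by apply: (addIr (kapp d 0)); rewrite -kappD addr0 add0r. Qed.

Lemma kapp_sum d I (r : seq I) (P : pred I) (z : I -> {ffun T -> A}) :
  kapp d (\sum_(i <- r | P i) z i) = \sum_(i <- r | P i) kapp d (z i).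
Proof.
elim: r => [|i r IH]; first by rewrite !big_nil kapp0.
by rewrite !big_cons; case: ifP => _; rewrite ?kappD IH.
Qed.

Lemma kapp_dg d w z : (forall t s, d t s * w s = w t * d t s) ->
  kapp d (dg w z) = dg w (kapp d z).
Proof.
move=> H; apply/ffunP => t; rewrite !ffunE mulr_sumr; apply: eq_bigr => s _.
by rewrite ffunE mulrA H mulrA.
Qed.

Lemma kapp_sc d f z : kapp d (sc f z) = sc f (kapp d z).
Proof. by apply: kapp_dg => t s; rewrite mulrC. Qed.

Lemma kapp_msk d (q : T -> bool) z : (forall t s, q t != q s -> d t s = 0) ->
  kapp d (msk q z) = msk q (kapp d z).
Proof.
move=> H; apply: kapp_dg => t s.
have := H t s; case: (q t); case: (q s) => //= H'; rewrite ?mul1r ?mulr1 ?mul0r ?mulr0 //.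
  by rewrite H'.
by rewrite H'.
Qed.

Lemma dgD w z z' : dg w (z + z') = dg w z + dg w z'.
Proof. by apply/ffunP => t; rewrite !ffunE mulrDr. Qed.

Lemma dgA w w' z : dg w (dg w' z) = dg (fun t => w t * w' t) z.
Proof. by apply/ffunP => t; rewrite !ffunE mulrA. Qed.

Lemma scA f g z : sc f (sc g z) = sc (f * g) z.
Proof. by rewrite /sc dgA. Qed.

Lemma scD f z z' : sc f (z + z') = sc f z + sc f z'.
Proof. exact: dgD. Qed.

Lemma scDl f g z : sc (f + g) z = sc f z + sc g z.
Proof. by apply/ffunP => t; rewrite !ffunE mulrDl. Qed.

Lemma sc0 z : sc 0 z = 0.
Proof. by apply/ffunP => t; rewrite !ffunE mul0r. Qed.

Lemma sc1 z : sc 1 z = z.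
Proof. by apply/ffunP => t; rewrite !ffunE mul1r. Qed.

Lemma scr0 f : sc f 0 = 0.
Proof. by apply/ffunP => t; rewrite !ffunE mulr0. Qed.

Lemma msk_sc q f z : msk q (sc f z) = sc f (msk q z).
Proof. by apply/ffunP => t; rewrite !ffunE mulrCA. Qed.

Lemma kappA d d' z : kapp d (kapp d' z) = kapp (kmul d d') z.
Proof.
apply/ffunP => t; rewrite !ffunE /kmul.
under eq_bigr => s _ do rewrite ffunE mulr_sumr.
rewrite exchange_big /=; apply: eq_bigr => s _.
by rewrite mulr_suml; apply: eq_bigr => r _; rewrite mulrA.
Qed.

Lemma kapp_homotopy d h z w : (forall t s, kmul d h t s + kmul h d t s = w s * (t == s)%:R) ->
  kapp d (kapp h z) + kapp h (kapp d z) = dg w z.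
Proof.
move=> H; rewrite !kappA; apply/ffunP => t; rewrite !ffunE -big_split /=.
rewrite (eq_bigr (fun s => (t == s)%:R * (w s * z s))) ?sum_deltal // => s _.
by rewrite -mulrDl H; ring.
Qed.

Lemma kapp_ext d d' z : (forall t s, d t s = d' t s) -> kapp d z = kapp d' z.
Proof. by move=> H; apply/ffunP => t; rewrite !ffunE; apply: eq_bigr => s _; rewrite H. Qed.

End Action.
End Kernels.

(** * The factorizations of one piece *)

Section PieceFactorizations.
Variables (F : fieldType) (n m : nat).
Local Notation A := {mpoly F[m]}.
Local Notation X i := ('X_i : A).
Local Notation p := (potential n).

Definition piece_potential (pc : piece m) : A :=
  \sum_(i <- exits pc) p (X i) - \sum_(j <- entrances pc) p (X j).

Definition distinct_ends (pc : piece m) := uniq (entrances pc ++ exits pc).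

(** Both C(Gamma_0) and C(Gamma_1) have this form: they are the tensor product of
    the factorizations (a1, b1) and (a2, b2), up to the sign of one generator.
    The matrices are linear in v, so that their squares can be polarized. *)
Definition block (v : A * A * A * A) (e : bool) : 'M[A]_2 :=
  let: (a1, b1, a2, b2) := v in
  if ~~ e then mx22 a1 b2 a2 (- b1) else mx22 b1 b2 a2 (- a1).

(** The entries (a1, b1, a2, b2) of the factorization of a piece; g selects the
    wide edge resolution of a crossing.  An arc has the trivial second factor. *)
Definition vec (pc : piece m) (g : bool) : A * A * A * A :=
  match pc with
  | Arc j i => (pi_ F n i j, X i - X j, 0, 0)
  | Crossing _ x1 x2 x3 x4 =>
      if g then (u1_ F n x1 x2 x3 x4, X x1 + X x2 - X x3 - X x4,
                 u2_ F n x1 x2 x3 x4, X x1 * X x2 - X x3 * X x4)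
      else (pi_ F n x1 x4, X x1 - X x4, pi_ F n x2 x3, X x2 - X x3)
  end.

(** The polar form of [quad]. *)
Definition polar (v w : A * A * A * A) : A :=
  let: (a1, b1, a2, b2) := v in let: (a1', b1', a2', b2') := w in
  a1 * b1' + a1' * b1 + a2 * b2' + a2' * b2.

Definition quad (v : A * A * A * A) : A :=
  let: (a1, b1, a2, b2) := v in a1 * b1 + a2 * b2.

Lemma quad_vec pc g : distinct_ends pc -> quad (vec pc g) = piece_potential pc.
Proof.
rewrite /distinct_ends /piece_potential; case: pc => [j i|pos x1 x2 x3 x4] U /=.
  rewrite !big_seq1 mul0r addr0 pi_E -?pquotP //.
  by move: U; rewrite /= inE eq_sym andbT.
have U' : uniq [:: x1; x2; x3; x4].
  by rewrite -[[:: _; _; _; _]]/([:: x1; x2] ++ [:: x3; x4]) uniq_catC.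
rewrite !big_cons !big_nil !addr0.
case: g; rewrite /= ?u12P ?pi1423P //;
  by move: (p _) (p _) (p _) (p _) => *; ring.
Qed.

Definition piece_res (pc : piece m) : gens (piece_complex F n pc) -> bool :=
  match pc with Arc _ _ => fun=> false | Crossing _ _ _ _ _ => fun b => b.1.1 end.

Definition piece_block (pc : piece m) (v : bool -> A * A * A * A) :
    gens (piece_complex F n pc) -> gens (piece_complex F n pc) -> A :=
  match pc with
  | Arc _ _ => fun t s => let: (a, b, _, _) := v false in
      match s, t with false, true => a | true, false => b | _, _ => 0 end
  | Crossing _ _ _ _ _ => fun t s =>
      let: (G', e', k') := t in let: (G, e, k) := s in
      if (G' == G) && (e' != e) then block (v G) e k' k else 0
  end.

Lemma mx22E (a b c d : A) k k' : mx22 a b c d k k' =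
  if k == 0 then (if k' == 0 then a else b) else (if k' == 0 then c else d).
Proof. by rewrite mxE. Qed.

Lemma dmf_block pc t s : @dmf _ (piece_complex F n pc) t s = piece_block (vec pc) t s.
Proof.
case: pc t s => [j i|pos x1 x2 x3 x4] //= [[G' e'] k'] [[G e] k].
case: ifP => // _; case: G; case: e; rewrite //= !mx22E; do 2 case: ifP => // _; ring.
Qed.
End PieceFactorizations.

Section NullHomotopies.
Variables (F : fieldType) (n m : nat).
Local Notation A := {mpoly F[m]}.
Local Notation X i := ('X_i : A).
Local Notation p := (potential n).

Lemma sum_cross (V : nmodType) (f : bool * bool * 'I_2 -> V) : \sum_r f r =
  \sum_(k < 2) (f (true, true, k) + f (true, false, k) + f (false, true, k) + f (false, false, k)).
Proof.
rewrite (eq_bigr (fun r => f (r.1.1, r.1.2, r.2))); last by case=> [[]].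
rewrite -(pair_bigA _ (fun r1 r2 => f (r1.1, r1.2, r2))) /=.
rewrite exchange_big /=; apply: eq_bigr => k _.
by rewrite -(pair_bigA _ (fun r1 r2 => f (r1, r2, k))) /= !big_bool /= !addrA.
Qed.

Lemma sum2 (V : nmodType) (f : 'I_2 -> V) : \sum_k f k = f 0 + f 1.
Proof. by rewrite !big_ord_recl big_ord0 addr0; congr (_ + f _); apply: val_inj. Qed.

Lemma ord2P (k : 'I_2) : {k = 0} + {k = 1}.
Proof. by case: k => [[|[|//]] ?]; [left | right]; apply: val_inj. Qed.

Lemma block_polar pos x1 x2 x3 x4 v w t s :
  let B := @piece_block F n m (Crossing pos x1 x2 x3 x4) in
  kmul (B v) (B w) t s + kmul (B w) (B v) t s = polar (v s.1.1) (w s.1.1) * (t == s)%:R.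
Proof.
case: t s => [[G' e'] k'] [[G e] k] /=; rewrite /kmul !sum_cross !sum2 !xpair_eqE /=.
have [->|->] := ord2P k; have [->|->] := ord2P k'; case: G'; case: G; case: e'; case: e;
  case: (v true) (v false) (w true) (w false) =>
    [[[? ?] ?] ?] [[[? ?] ?] ?] [[[? ?] ?] ?] [[[? ?] ?] ?];
  rewrite /= ?mx22E ?eqxx /= ?mulr0 ?mul0r ?addr0 ?add0r //; ring.
Qed.

Lemma arc_polar j i w t s :
  let B := @piece_block F n m (Arc j i) in let v := vec F n (Arc j i) in
  kmul (B v) (B w) t s + kmul (B w) (B v) t s = polar (v false) (w false) * (t == s)%:R.
Proof.
rewrite /kmul !big_bool /=; case: (w false) => [[[a' b'] a2'] b2'] /=.
by case: t; case: s; rewrite /= ?eqxx /=; ring.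
Qed.

(** Polarization of the fact that the square of the factorization with entries v
    is [quad v]: any choice of w is a homotopy, and unit vectors w give that the
    entries themselves are null-homotopic. *)
Lemma piece_polar (pc : piece m) w t s :
  let M := @dmf _ (piece_complex F n pc) in
  let B := @piece_block F n m pc w in
  kmul M B t s + kmul B M t s =
    polar (vec F n pc (piece_res s)) (w (piece_res s)) * (t == s)%:R.
Proof.
move=> M B; pose M' := @piece_block F n m pc (vec F n pc).
have -> : M = M' by apply/funext => x; apply/funext => y; exact: dmf_block.
case: pc w t s @M @B @M' => [j i|pos x1 x2 x3 x4] w t s M B M'.
  exact: arc_polar.
exact: block_polar.
Qed.

End NullHomotopies.

Section CrossingMaps.
Variables (F : fieldType) (n m : nat).
Local Notation A := {mpoly F[m]}.
Local Notation X i := ('X_i : A).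
Local Notation p := (potential n).
Section CrossingChi.
Variables i1 i2 i3 i4 : 'I_m.
Hypothesis U : uniq [:: i1; i2; i3; i4].
Local Notation x1 := (X i1).
Local Notation x2 := (X i2).
Local Notation x3 := (X i3).
Local Notation x4 := (X i4).

Lemma pi23E : pi_ F n i2 i3 = u2_ F n i1 i2 i3 i4 * (x4 - x2) + pi_ F n i1 i4
  - a_ F n i1 i2 i3 i4 * (x1 + x2 - x3 - x4).
Proof. by rewrite a_P //; ring. Qed.

(** Together with [pi23E] this expresses pi_23 and u1 through pi_14, u2 and a,
    after which commutation with chi_0 and chi_1 is a polynomial identity. *)
Lemma u1E : u1_ F n i1 i2 i3 i4 = pi_ F n i1 i4 - a_ F n i1 i2 i3 i4 * (x2 - x3)
  - x2 * u2_ F n i1 i2 i3 i4.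
Proof.
apply: (mulIf (ds_neq0 F U)); apply: (addIr (u2_ F n i1 i2 i3 i4 * (x1 * x2 - x3 * x4))).
by rewrite u12P -(pi1423P F n U) pi23E; ring.
Qed.

Lemma dmf_dchi pos t s :
  let C := crossing_complex F n pos i1 i2 i3 i4 in
  kmul (@dmf _ C) (@dchi _ C) t s = kmul (@dchi _ C) (@dmf _ C) t s.
Proof.
case: t s => [[G' e'] k'] [[G e] k] /=; rewrite /kmul !sum_cross !sum2 /=.
rewrite /Pmx /Qmx /chi0mx /chi1mx /= pi23E u1E.
move: (pi_ _ _ _ _) (u2_ _ _ _ _ _ _) (a_ _ _ _ _ _ _) => P u a.
have [->|->] := ord2P k; have [->|->] := ord2P k'; case: pos; case: G'; case: G;
  case: e'; case: e;
  rewrite /= ?mx22E ?eqxx /= ?mulr0 ?mul0r ?addr0 ?add0r //; ring.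
Qed.

(** The two maps chi_0 and chi_1 of a crossing are inverse to each other up to
    the factor x4 - x2, hence each is a homotopy for the other. *)
Lemma dchi_homotopy pos t s :
  let C := crossing_complex F n pos i1 i2 i3 i4 in
  let C' := crossing_complex F n (~~ pos) i1 i2 i3 i4 in
  kmul (@dchi _ C) (@dchi _ C') t s + kmul (@dchi _ C') (@dchi _ C) t s =
    (x4 - x2) * (t == s)%:R.
Proof.
case: t s => [[G' e'] k'] [[G e] k] /=; rewrite /kmul !sum_cross !sum2 !xpair_eqE /=.
rewrite /chi0mx /chi1mx /=; move: (a_ _ _ _ _ _ _) => a.
have [->|->] := ord2P k; have [->|->] := ord2P k'; case: pos; case: G'; case: G;
  case: e'; case: e;
  rewrite /= ?mx22E ?eqxx /= ?mulr0 ?mul0r ?addr0 ?add0r //; ring.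
Qed.

End CrossingChi.

Definition hsign (h : int) : A := (-1) ^+ absz h.

Section Degrees.
Variable pc : piece m.
Local Notation C := (piece_complex F n pc).

Lemma block_odd v (t s : gens C) : parity t == parity s -> @piece_block F n m pc v t s = 0.
Proof.
case: pc t s => [j i|pos x1 x2 x3 x4] t s.
  by rewrite /=; case: (v false) => [[[? ?] ?] ?]; case: t; case: s.
case: t s => [[G' e'] k'] [[G e] k] /= /eqP ->; by rewrite eqxx andbF.
Qed.

Lemma block_res v (t s : gens C) : piece_res t != piece_res s -> @piece_block F n m pc v t s = 0.
Proof.
case: pc t s => [j i|pos x1 x2 x3 x4] t s; first by rewrite eqxx.
by case: t s => [[G' e'] k'] [[G e] k] /= /negPf ->.
Qed.

Lemma hdeg_res (t s : gens C) : piece_res t = piece_res s -> hdeg t = hdeg s.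
Proof.
case: pc t s => [j i|pos x1 x2 x3 x4] t s //.
by case: t s => [[G' e'] k'] [[G e] k] /= ->.
Qed.

Lemma dchi_res (t s : gens C) : piece_res t = piece_res s -> dchi t s = 0.
Proof.
case: pc t s => [j i|pos x1 x2 x3 x4] t s //.
by case: t s => [[G' e'] k'] [[G e] k] /= ->; rewrite eqxx andbF.
Qed.

Lemma dchi_parity (t s : gens C) : parity t != parity s -> dchi t s = 0.
Proof.
case: pc t s => [j i|pos x1 x2 x3 x4] t s //.
by case: t s => [[G' e'] k'] [[G e] k] /= /negPf ->; rewrite !andbF.
Qed.

Lemma hsign_res (t s : gens C) : piece_res t != piece_res s ->
  hsign (hdeg t) = - hsign (hdeg s).
Proof.
case: pc t s => [j i|pos x1 x2 x3 x4] t s; first by rewrite eqxx.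
case: t s => [[G' e'] k'] [[G e] k] /=; rewrite /hsign.
by case: G'; case: G; case: pos => //= _; rewrite ?expr1 ?expr0 ?opprK.
Qed.

End Degrees.
End CrossingMaps.

(** * The complex of a diagram *)

Section DiagramFacts.
Variables (F : fieldType) (n m : nat).
Local Notation A := {mpoly F[m]}.
Local Notation X i := ('X_i : A).
Local Notation C D := (diagram_complex F n D).

Fixpoint resolution (D : seq (piece m)) : gens (C D) -> seq bool :=
  match D with
  | [::] => fun=> [::]
  | pc :: D' => fun b => piece_res b.1 :: resolution b.2
  end.

Lemma good_crossing pos (x1 x2 x3 x4 : 'I_m) :
  distinct_ends (Crossing pos x1 x2 x3 x4) -> uniq [:: x1; x2; x3; x4].
Proof. by rewrite -[[:: _; _; _; _]]/([:: x1; x2] ++ [:: x3; x4]) uniq_catC. Qed.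

Definition psign (P : mfcomplex A) (b : gens P) : A := (-1) ^+ parity b.

Lemma dmf_cons pc D : @dmf _ (C (pc :: D)) =
  tensor_kernel (@dmf _ (piece_complex F n pc)) (@psign _) (@dmf _ (C D)).
Proof. by []. Qed.

Lemma dchi_cons pc D : @dchi _ (C (pc :: D)) =
  tensor_kernel (@dchi _ (piece_complex F n pc)) (fun b => hsign F m (hdeg b)) (@dchi _ (C D)).
Proof. by []. Qed.

Lemma psignK (P : mfcomplex A) (b : gens P) : psign b * psign b = 1.
Proof. by rewrite /psign -expr2 sqrr_sign. Qed.

Lemma hsignK h : hsign F m h * hsign F m h = 1.
Proof. by rewrite /hsign -expr2 sqrr_sign. Qed.

Lemma block_odd_sign pc v (t s : gens (piece_complex F n pc)) :
  @piece_block F n m pc v t s * (psign t + psign s) = 0.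
Proof.
have [pts|pts] := eqVneq (parity t) (parity s).
  by rewrite block_odd ?pts // mul0r.
rewrite /psign; case: (parity t) pts; case: (parity s) => //= _.
  by rewrite addNr mulr0.
by rewrite addrN mulr0.
Qed.

Lemma piece_dmf_odd pc (t s : gens (piece_complex F n pc)) : dmf t s * (psign t + psign s) = 0.
Proof. by rewrite dmf_block; exact: block_odd_sign. Qed.

Lemma piece_dmf_hsign pc (t s : gens (piece_complex F n pc)) :
  dmf t s * (hsign F m (hdeg t) - hsign F m (hdeg s)) = 0.
Proof.
rewrite dmf_block; have [e|ne] := eqVneq (piece_res t) (piece_res s).
  by rewrite (hdeg_res e) subrr mulr0.
by rewrite block_res // mul0r.
Qed.

Lemma piece_dchi_psign pc (t s : gens (piece_complex F n pc)) :
  dchi t s * (psign t - psign s) = 0.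
Proof.
have [pts|pts] := eqVneq (parity t) (parity s); last by rewrite dchi_parity ?mul0r.
by rewrite /psign pts subrr mulr0.
Qed.

Lemma piece_dchi_hsign pc (t s : gens (piece_complex F n pc)) :
  dchi t s * (hsign F m (hdeg t) + hsign F m (hdeg s)) = 0.
Proof.
have [e|ne] := eqVneq (piece_res t) (piece_res s); first by rewrite dchi_res // mul0r.
by rewrite (hsign_res ne) addNr mulr0.
Qed.

Lemma diagram_commute D (t s : gens (C D)) : all (@distinct_ends m) D ->
  kmul (@dmf _ (C D)) (@dchi _ (C D)) t s = kmul (@dchi _ (C D)) (@dmf _ (C D)) t s.
Proof.
elim: D t s => [|pc D IH] t s; first by rewrite !kmul0l.
case/andP => gp gD; rewrite dmf_cons dchi_cons.
rewrite !tensor_kernel_mul IH //.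
have -> : kmul (@dmf _ (piece_complex F n pc)) (@dchi _ (piece_complex F n pc)) t.1 s.1 =
    kmul (@dchi _ (piece_complex F n pc)) (@dmf _ (piece_complex F n pc)) t.1 s.1.
  case: pc gp t s {IH} => [j i|pos x1 x2 x3 x4] gp t s.
    by rewrite kmul0l kmul0r.
  exact/dmf_dchi/(good_crossing gp).
have /(congr1 (fun x => x * dchi t.2 s.2)) := piece_dmf_hsign t.1 s.1.
have /(congr1 (fun x => x * dmf t.2 s.2)) := piece_dchi_psign t.1 s.1.
rewrite !mul0r => H1 H2; apply/eqP; rewrite -subr_eq0; apply/eqP.
by rewrite -[RHS](subr0 0) -{1}H1 -H2; ring.
Qed.

Lemma dmf_resolution D (t s : gens (C D)) : resolution t != resolution s -> dmf t s = 0.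
Proof.
elim: D t s => [|pc D IH] [] //= t1 t2 [s1 s2] /=.
rewrite eqseq_cons negb_and => /orP[ne|ne].
  rewrite dmf_block block_res // mul0r add0r.
  by have [e|_] := eqVneq t1 s1; [rewrite e eqxx in ne | rewrite mulr0 mul0r].
rewrite IH // mulr0 addr0.
by have [e|_] := eqVneq t2 s2; [rewrite e eqxx in ne | rewrite mulr0].
Qed.

Lemma dchi_resolution D (t s : gens (C D)) : resolution t = resolution s -> dchi t s = 0.
Proof.
elim: D t s => [|pc D IH] [] //= t1 t2 [s1 s2] /= [e1 e2].
by rewrite dchi_res // IH // mul0r mulr0 addr0.
Qed.

(** The local homotopy of the piece pc extends to the diagram, because it is odd
    and the signs cancel against the differentials of the other pieces. *)
Lemma diagram_null D1 pc D2 w : let D := D1 ++ pc :: D2 in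
  exists h : gens (C D) -> gens (C D) -> A, forall t s,
    kmul (@dmf _ (C D)) h t s + kmul h (@dmf _ (C D)) t s =
    polar (vec F n pc (nth false (resolution s) (size D1))) w * (t == s)%:R.
Proof.
elim: D1 => [|pc1 D1 [h Hh]] D; rewrite /D {D} [_ ++ _]/=.
  exists (tensor_kernel (@piece_block F n m pc (fun=> w)) (@psign _) (fun _ _ => 0)).
  move=> t s; rewrite dmf_cons !tensor_kernel_mul kmul0l kmul0r !mulr0.
  have H := piece_polar (fun=> w) t.1 s.1.
  have /(congr1 (fun x => x * dmf t.2 s.2)) := block_odd_sign (fun=> w) t.1 s.1.
  rewrite mul0r => H2.
  case: t s H H2 => [t1 t2] [s1 s2] /= H H2.
  rewrite xpair_eqE -mulnb natrM mulrA -H -[RHS]addr0 -[Y in _ = _ + Y]H2; ring.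
exists (tensor_kernel (fun _ _ => 0) (@psign _) h).
move=> t s; rewrite dmf_cons !tensor_kernel_mul kmul0l kmul0r !mulr0 !mul0r !add0r.
have /(congr1 (fun x => x * h t.2 s.2)) := piece_dmf_odd t.1 s.1.
rewrite mul0r => H2; have := Hh t.2 s.2.
case: t s H2 => [t1 t2] [s1 s2] /= H2 H; rewrite !psignK.
rewrite xpair_eqE -mulnb natrM mulrCA -H -[RHS]addr0 -[Y in _ = _ + Y]H2; ring.
Qed.

Lemma diagram_chi_homotopy D1 pos x1 x2 x3 x4 D2 :
  let D := D1 ++ Crossing pos x1 x2 x3 x4 :: D2 in all (@distinct_ends m) D ->
  exists h : gens (C D) -> gens (C D) -> A,
    (forall t s, kmul (@dmf _ (C D)) h t s = kmul h (@dmf _ (C D)) t s) /\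
    forall t s, kmul (@dchi _ (C D)) h t s + kmul h (@dchi _ (C D)) t s =
      (X x4 - X x2) * (t == s)%:R.
Proof.
elim: D1 => [|pc1 D1 IH] D; rewrite /D {D} [_ ++ _]/=.
  case/andP => gp gD.
  have U := good_crossing gp.
  pose P := piece_complex F n (Crossing pos x1 x2 x3 x4).
  pose h : gens P -> gens P -> A :=
    @dchi _ (piece_complex F n (Crossing (~~ pos) x1 x2 x3 x4)).
  have h1 (t s : gens P) : kmul (@dmf _ P) h t s = kmul h (@dmf _ P) t s.
    exact: (@dmf_dchi F n m _ _ _ _ U (~~ pos) t s).
  have h2 (t s : gens P) : kmul (@dchi _ P) h t s + kmul h (@dchi _ P) t s =
      (X x4 - X x2) * (t == s)%:R by exact: (@dchi_homotopy F n m x1 x2 x3 x4 pos t s).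
  have hp (t s : gens P) : h t s * (psign t - psign s) = 0.
    exact: (@piece_dchi_psign (Crossing (~~ pos) x1 x2 x3 x4) t s).
  have hh (t s : gens P) : h t s * (hsign F m (hdeg t) + hsign F m (hdeg s)) = 0.
    rewrite /h; have [e|ne] := eqVneq (piece_res t) (piece_res s).
      by rewrite (@dchi_res F n m (Crossing (~~ pos) x1 x2 x3 x4) t s e) mul0r.
    by rewrite (hsign_res ne) addNr mulr0.
  exists (tensor_kernel h (fun b => hsign F m (@hdeg _ P b)) (fun _ _ => 0)).
  split=> t s.
    rewrite dmf_cons !tensor_kernel_mul h1 kmul0l kmul0r !mulr0.
    have /(congr1 (fun x => x * dmf t.2 s.2)) := hp t.1 s.1.
    rewrite mul0r => H; apply/eqP; rewrite -subr_eq0; apply/eqP; rewrite -[RHS]H; ring.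
  rewrite dchi_cons !tensor_kernel_mul kmul0l kmul0r !mulr0.
  have := h2 t.1 s.1; have /(congr1 (fun x => x * dchi t.2 s.2)) := hh t.1 s.1.
  case: t s => [t1 t2] [s1 s2] /=; rewrite mul0r => H2 H.
  rewrite xpair_eqE -mulnb natrM mulrA -H -[RHS]addr0 -[Y in _ = _ + Y]H2; ring.
case/andP => gp gD; have [h [h1 h2]] := IH gD.
pose P := piece_complex F n pc1.
exists (tensor_kernel (fun _ _ => 0) (fun b => hsign F m (@hdeg _ P b)) h).
split=> t s.
  rewrite dmf_cons !tensor_kernel_mul h1 kmul0l kmul0r !mulr0 !mul0r !add0r.
  have /(congr1 (fun x => x * h t.2 s.2)) := piece_dmf_hsign t.1 s.1.
  rewrite mul0r => H; apply/eqP; rewrite -subr_eq0 -oppr_eq0; apply/eqP; rewrite -[RHS]H; ring.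
rewrite dchi_cons !tensor_kernel_mul kmul0l kmul0r !mulr0 !mul0r !add0r !hsignK.
have := h2 t.2 s.2; have /(congr1 (fun x => x * h t.2 s.2)) := piece_dchi_hsign t.1 s.1.
case: t s => [t1 t2] [s1 s2] /=; rewrite mul0r => H2 H.
rewrite xpair_eqE -mulnb natrM mulrCA -H -[RHS]addr0 -[Y in _ = _ + Y]H2; ring.
Qed.

End DiagramFacts.

(** * The Koszul factorization of a list of edges *)

Section Koszul.
Variables (F : fieldType) (n m : nat).
Local Notation A := {mpoly F[m]}.
Local Notation X i := ('X_i : A).
Local Notation p := (potential n).

(** The two components of a pair belong to the even and the odd generator of the
    first edge. *)
Fixpoint koszul (k : nat) : lmodType A :=
  match k with 0 => A^o | k'.+1 => (koszul k' * koszul k')%type end.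

Implicit Types (s : 'I_m -> A) (l : seq ('I_m * 'I_m)).

(** The points take values in an arbitrary way, so that variables can be
    eliminated without changing the ring. *)
Fixpoint kd s l : koszul (size l) -> koszul (size l) :=
  match l with
  | [::] => fun=> 0
  | (j, i) :: l' => fun y =>
      ((s i - s j) *: y.2 + kd s (l := l') y.1,
       pquot n (s i) (s j) *: y.1 - kd s (l := l') y.2)
  end.

Fixpoint kmap (f : A -> A) k : koszul k -> koszul k :=
  match k with
  | 0 => f
  | k'.+1 => fun y => (kmap f y.1, kmap f y.2)
  end.

(** The coordinate at the generator that is odd exactly on the flagged edges. *)
Fixpoint coordinate (fl : seq bool) k : koszul k -> A :=
  match k with
  | 0 => id
  | k'.+1 => fun y => coordinate (behead fl) (if head false fl then y.2 else y.1)
  end.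

Lemma pair_eqP k (x y : koszul k.+1) : x.1 = y.1 -> x.2 = y.2 -> x = y.
Proof. by case: x y => [? ?] [? ?] /= -> ->. Qed.

Lemma kdD s l (y z : koszul (size l)) : kd s (y + z) = kd s y + kd s z.
Proof.
elim: l y z => [|[j i] l IH] y z /=; first by rewrite addr0.
by apply: (@pair_eqP (size l)); rewrite /= IH scalerDr ?opprD addrACA.
Qed.

Lemma kdZ s l c (y : koszul (size l)) : kd s (c *: y) = c *: kd s y.
Proof.
elim: l y => [|[j i] l IH] y /=; first by rewrite scaler0.
by apply: (@pair_eqP (size l)); rewrite /= IH scalerDr ?scalerN !scalerA mulrC.
Qed.

Lemma kdB s l (y z : koszul (size l)) : kd s (y - z) = kd s y - kd s z.
Proof. by rewrite kdD -scaleN1r kdZ scaleN1r. Qed.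

Lemma kd0 s l : kd s (0 : koszul (size l)) = 0.
Proof. by rewrite -[0 in LHS](@scale0r A (koszul (size l)) 0) kdZ scale0r. Qed.

Definition edge_potential s l : A := \sum_(e <- l) (p (s e.2) - p (s e.1)).

Lemma kd_square s l (y : koszul (size l)) : kd s (kd s y) = edge_potential s l *: y.
Proof.
rewrite /edge_potential.
elim: l y => [|[j i] l IH] y /=; first by rewrite big_nil scale0r.
rewrite big_cons /= pquotP; apply: (@pair_eqP (size l)); rewrite /=.
  by rewrite kdD kdZ IH scalerBr addrA subrK scalerA -scalerDl [_ * pquot _ _ _]mulrC.
rewrite kdB kdZ IH scalerDr scalerA opprB -addrA [_ *: kd _ _ + _]addrC subrK.
by rewrite -scalerDl.
Qed.

Lemma kmapD (f : {rmorphism A -> A}) k (y z : koszul k) : kmap f (y + z) = kmap f y + kmap f z.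
Proof.
elim: k y z => [|k IH] y z; first exact: rmorphD.
by apply: (@pair_eqP k); rewrite /= IH.
Qed.

Lemma kmapZ (f : {rmorphism A -> A}) k c (y : koszul k) : kmap f (c *: y) = f c *: kmap f y.
Proof.
elim: k y => [|k IH] y; first exact: rmorphM.
by apply: (@pair_eqP k); rewrite /= IH.
Qed.

Lemma kmapB (f : {rmorphism A -> A}) k (y z : koszul k) : kmap f (y - z) = kmap f y - kmap f z.
Proof. by rewrite kmapD -scaleN1r kmapZ rmorphN1 scaleN1r. Qed.

Lemma kmap0 (f : {rmorphism A -> A}) k : kmap f (0 : koszul k) = 0.
Proof. by rewrite -[0 in LHS](@scale0r A (koszul k) 0) kmapZ rmorph0 scale0r. Qed.

Lemma kmap_kd (f : {rmorphism A -> A}) s s' l (y : koszul (size l)) :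
  (forall k, f (s k) = s' k) -> kmap f (kd s y) = kd s' (kmap f y).
Proof.
move=> fs; elim: l y => [|[j i] l IH] y /=; first exact: rmorph0.
apply: (@pair_eqP (size l)); rewrite /=.
  by rewrite kmapD kmapZ rmorphB !fs IH.
by rewrite kmapB kmapZ rmorph_pquot !fs IH.
Qed.

Lemma kmap_comp (f g h : A -> A) k (y : koszul k) : (forall x, f (g x) = h x) ->
  kmap f (kmap g y) = kmap h y.
Proof.
by move=> e; elim: k y => [|k IH] y /=; [exact: e | apply: (@pair_eqP k); apply: IH].
Qed.

Lemma koszul_torsion_free c k (y : koszul k) : c != 0 -> c *: y = 0 -> y = 0.
Proof.
move=> c0; elim: k y => [|k IH] y.
  by move=> /eqP; rewrite [_ *: _]/(c * y) mulf_eq0 (negPf c0) => /eqP.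
by case: y => [u v] [/IH-> /IH->].
Qed.

Lemma kmap_subst_divides (j : 'I_m) (t : A) k (y : koszul k) :
  let f := subst (fun i => if i == j then t else X i) in
  exists z, y - kmap f y = (t - X j) *: z.
Proof.
move=> f; elim: k y => [|k IH] y; first exact: subst_divides.
have [z1 H1] := IH y.1; have [z2 H2] := IH y.2.
by exists (z1, z2); apply: (@pair_eqP k); rewrite /= ?H1 ?H2.
Qed.

Lemma coordinateD fl k (y z : koszul k) :
  coordinate fl (y + z) = coordinate fl y + coordinate fl z.
Proof. by elim: k fl y z => [|k IH] fl y z //=; case: ifP => _; rewrite IH. Qed.

Lemma coordinateZ fl k c (y : koszul k) : coordinate fl (c *: y) = c * coordinate fl y.
Proof. by elim: k fl y => [|k IH] fl y //=; case: ifP => _; rewrite IH. Qed.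

Lemma coordinate_kmap (f : {rmorphism A -> A}) fl k (y : koszul k) :
  coordinate fl (kmap f y) = f (coordinate fl y).
Proof. by elim: k fl y => [|k IH] fl y //=; case: ifP => _; rewrite IH. Qed.

Lemma coordinateN fl k (y : koszul k) : coordinate fl (- y) = - coordinate fl y.
Proof. by rewrite -scaleN1r coordinateZ mulN1r. Qed.

(** At a point where all values agree and are roots of unity, all entries of the
    differential vanish. *)
Lemma coordinate_kd_eval (v : 'I_m -> F) fl s l (y : koszul (size l)) (c : F) :
  c ^+ n = 1 -> (forall k, (s k).@[v] = c) -> (coordinate fl (kd s y)).@[v] = 0.
Proof.
move=> cn sv; elim: l fl y => [|[j i] l IH] fl y /=; first by rewrite meval0.
have ev_pquot : (pquot n (s i) (s j)).@[v] = 0.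
  by rewrite (rmorph_pquot (meval v)) /= !sv pquot_diag cn subrr mulr0.
case: ifP => _; rewrite /= coordinateD coordinateZ ?coordinateN.
  by rewrite mevalB mevalM ev_pquot IH mul0r subrr.
by rewrite mevalD mevalM mevalB !sv subrr IH mul0r addr0.
Qed.

(** A map rho sends each point to a representative of its class.  The source j of
    the next edge is always a representative: each point is the source of one
    edge only, and only sources of earlier edges have been replaced.  So the edge
    closes a circle exactly when the representative of i is j. *)
Definition contract (rho : 'I_m -> 'I_m) j i k := if rho k == j then rho i else rho k.

Fixpoint closing rho l : seq bool :=
  if l is (j, i) :: l' then (rho i == j) :: closing (contract rho j i) l' else [::].

Definition sources l := [seq e.1 | e <- l].

Definition closing_sources rho l := mask (closing rho l) (sources l).

End Koszul.

(** * Idempotents *)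

Section Lagrange.
Variables (F : fieldType) (n m : nat).
Local Notation A := {mpoly F[m]}.
Local Notation X i := ('X_i : A).
Hypothesis n_gt0 : (0 < n)%N.
Hypothesis charF : forall k, k.+1%:R != 0 :> F.

(** The Lagrange interpolation polynomial at the root c of x^n - 1. *)
Definition lagrange (c : F) : {poly F} :=
  (c / n%:R) *: \sum_(i < n) c ^+ i *: 'X^(n.-1 - i).

Definition idem (c : F) (x : A) : A := (map_poly (@mpolyC m F) (lagrange c)).[x].

Lemma nF : n%:R != 0 :> F.
Proof. by rewrite -(prednK n_gt0). Qed.

Lemma lagrange_mul c : c ^+ n = 1 -> ('X - c%:P) * lagrange c = (c / n%:R) *: ('X^n - 1).
Proof.
move=> cn; rewrite -scalerAr; congr (_ *: _).
have -> : 'X^n - 1 = 'X^n - c%:P ^+ n :> {poly F} by rewrite -polyC_exp cn.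
rewrite subrXX; congr (_ * _); apply: eq_bigr => i _.
by rewrite -polyC_exp mulrC mul_polyC.
Qed.

Lemma lagrange_self c : c ^+ n = 1 -> (lagrange c).[c] = 1.
Proof.
move=> cn; rewrite hornerZ horner_sum (eq_bigr (fun=> c ^+ n.-1)).
  rewrite sumr_const card_ord -[c ^+ _ *+ n]mulr_natl mulrA divfK ?nF //.
  by rewrite -exprS prednK.
move=> i _; rewrite hornerZ hornerXn -exprD; congr (_ ^+ _).
by have := ltn_ord i; lia.
Qed.

Lemma size_lagrange c : (size (lagrange c) <= n)%N.
Proof.
apply: (leq_trans (size_scale_leq _ _)); apply: (leq_trans (size_sum _ _ _)).
apply/bigmax_leqP => i _; apply: (leq_trans (size_scale_leq _ _)).
by rewrite size_polyXn; have := ltn_ord i; lia.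
Qed.

Lemma lagrange_other c d : c ^+ n = 1 -> d ^+ n = 1 -> c != d -> (lagrange c).[d] = 0.
Proof.
move=> cn dn cd; have H : (d - c) * (lagrange c).[d] = 0.
  rewrite -hornerXsubC -hornerM lagrange_mul // hornerZ.
  by rewrite hornerD hornerN hornerXn hornerC dn subrr mulr0.
by move/eqP: H; rewrite mulf_eq0 subr_eq0 eq_sym (negPf cd) => /eqP.
Qed.

(** A polynomial of degree less than n is determined by its values at n
    distinct points. *)
Lemma sum_lagrange (r : seq F) : uniq r -> size r = n ->
  (forall c, c \in r -> c ^+ n = 1) -> \sum_(c <- r) lagrange c = 1.
Proof.
move=> ur sr rn; apply/eqP; rewrite -subr_eq0; apply/eqP.
apply: (@roots_geq_poly_eq0 _ _ r) => //.
  apply/allP => d dr; rewrite rootE hornerD hornerN horner_sum [1.[d]]hornerC subr_eq0.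
  rewrite (bigD1_seq d) //= lagrange_self ?rn // big1_seq ?addr0 // => c /andP[cd cr].
  by rewrite lagrange_other ?rn.
rewrite sr; apply: (leq_trans (size_polyD _ _)).
rewrite geq_max size_polyN size_poly1 n_gt0 andbT.
apply: (leq_trans (size_sum _ _ _)); rewrite big_seq.
by apply/bigmax_leqP_seq => c _ _; exact: size_lagrange.
Qed.

Lemma idem_mul c x : c ^+ n = 1 ->
  idem c x * (x - c%:MP) = (c / n%:R / n.+1%:R)%:MP * pquot n x x.
Proof.
move=> cn; have := congr1 (fun q => (map_poly (@mpolyC m F) q).[x]) (lagrange_mul cn).
rewrite /= rmorphM hornerM rmorphB /= map_polyX map_polyC /= hornerXsubC mulrC => ->.
rewrite map_polyZ hornerZ rmorphB /= map_polyXn rmorph1 hornerD hornerN hornerXn hornerC.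
rewrite pquot_diag mulrA; congr (_ * _).
have <- : (n.+1%:R)%:MP_[m] = n.+1%:R :> A by exact: (rmorph_nat (@mpolyC m F)).
by rewrite -mpolyCM divfK.
Qed.

Lemma sum_idem r x : uniq r -> size r = n -> (forall c, c \in r -> c ^+ n = 1) ->
  \sum_(c <- r) idem c x = 1.
Proof.
move=> ur sr rn; have := congr1 (fun q => (map_poly (@mpolyC m F) q).[x]) (sum_lagrange ur sr rn).
by rewrite /= rmorph_sum rmorph1 horner_sum hornerC.
Qed.

Lemma meval_idem v c x : (idem c x).@[v] = (lagrange c).[x.@[v]].
Proof.
rewrite /idem -(horner_map (meval v)) -map_poly_comp; congr (_.[_]).
by rewrite map_poly_id // => a _; rewrite /= mevalC.
Qed.

Lemma subst_idem h c x : subst h (idem c x) = idem c (subst h x).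
Proof.
rewrite /idem -horner_map; congr (_.[_]); rewrite -map_poly_comp.
by apply: eq_map_poly => a; rewrite /= substC.
Qed.

End Lagrange.

(** * Degrees *)

Section Degree.
Variables (F : fieldType) (n m : nat).
Local Notation A := {mpoly F[m]}.
Local Notation X i := ('X_i : A).

Definition degree_le (f : A) (d : int) :=
  forall mon, mon \in msupp f -> (mdeg mon)%:Z *+ 2 <= d.

Lemma degree_le_trans f d e : degree_le f d -> d <= e -> degree_le f e.
Proof. by move=> H de mon /H; move/le_trans; apply. Qed.

Lemma degree_le0 d : degree_le 0 d.
Proof. by move=> mon; rewrite msupp0. Qed.

Lemma degree_leD f g d : degree_le f d -> degree_le g d -> degree_le (f + g) d.
Proof. by move=> Hf Hg mon /msuppD_le; rewrite mem_cat => /orP[/Hf|/Hg]. Qed.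

Lemma degree_leN f d : degree_le f d -> degree_le (- f) d.
Proof. by move=> Hf mon; rewrite (perm_mem (msuppN f)); apply: Hf. Qed.

Lemma degree_leM f g d e : degree_le f d -> degree_le g e -> degree_le (f * g) (d + e).
Proof.
move=> Hf Hg mon /msuppM_le /allpairsP [[m1 m2] /= [/Hf H1 /Hg H2 ->]].
by rewrite mdegD PoszD mulrnDl lerD.
Qed.

Lemma degree_leC c : degree_le c%:MP 0.
Proof. by move=> mon; rewrite msuppC; case: ifP => // _; rewrite inE => /eqP->; rewrite mdeg0. Qed.

Lemma degree_leX i : degree_le (X i) 2.
Proof. by move=> mon; rewrite msuppX inE => /eqP->; rewrite mdeg1. Qed.

Lemma degree_le_nat k : degree_le k%:R 0.
Proof.
have <- : (k%:R)%:MP_[m] = k%:R :> A by exact: (rmorph_nat (@mpolyC m F)).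
exact: degree_leC.
Qed.

Lemma degree_le_exp f d k : degree_le f d -> degree_le (f ^+ k) (d *+ k).
Proof.
move=> Hf; elim: k => [|k IH]; first by rewrite expr0 mulr0n; apply: (@degree_le_nat 1).
by rewrite exprS mulrS; apply: degree_leM.
Qed.

Lemma degree_le_sum I (r : seq I) (P : pred I) (f : I -> A) d :
  (forall i, P i -> degree_le (f i) d) -> degree_le (\sum_(i <- r | P i) f i) d.
Proof.
move=> H; apply: (big_ind (fun g => degree_le g d)) => //; [exact: degree_le0 | move=> x y; exact: degree_leD].
Qed.

Lemma degree_le_prod I (r : seq I) (f : I -> A) d :
  (forall i, degree_le (f i) d) -> degree_le (\prod_(i <- r) f i) (d *+ size r).
Proof.
move=> H; elim: r => [|i r IH]; first by rewrite big_nil; apply: (@degree_le_nat 1).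
by rewrite big_cons mulrS; apply: degree_leM.
Qed.

Lemma degree_le_pquot i j : degree_le (pquot n (X i) (X j)) (n%:Z *+ 2).
Proof.
apply: degree_leD; last first.
  by apply: degree_leN; apply: degree_le_trans (@degree_le_nat n.+1) _.
apply: degree_le_sum => k _.
have H := degree_leM (@degree_le_exp _ _ (n - k)%N (@degree_leX i)) (@degree_le_exp _ _ k (@degree_leX j)).
by apply: degree_le_trans H _; have := ltn_ord k; lia.
Qed.

Lemma degree_le_idem c i : (0 < n)%N -> degree_le (idem n c (X i)) ((n%:Z - 1) *+ 2).
Proof.
move=> n0; rewrite /idem horner_coef; apply: degree_le_sum => k _; rewrite coef_map /=.
have H := degree_leM (@degree_leC ((lagrange n c)`_k)) (@degree_le_exp _ _ k (@degree_leX i)).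
apply: degree_le_trans H _.
have := ltn_ord k; have := size_lagrange n0 c.
by rewrite [Y in (_ < Y)%N -> _]size_map_poly; lia.
Qed.

Lemma degree_le_div i j f d : i != j ->
  degree_le ((X i - X j) * f) (d + 2) -> degree_le f d.
Proof.
move=> ij H mon monf; have f0 : f != 0 by apply: contraTneq monf => ->; rewrite msupp0.
have b0 : X i - X j != 0 by rewrite X_neq.
have lM := mleadM b0 f0.
have db : mdeg (mlead (X i - X j)) = 1%N.
  have := mlead_supp b0; move/msuppB_le; rewrite mem_cat !msuppX !inE.
  by case/orP => /eqP->; rewrite mdeg1.
have := H (mlead ((X i - X j) * f)); rewrite mlead_supp ?mulf_neq0 // => /(_ isT).
rewrite lM mdegD db.
have := msize_mdeg_lt monf; rewrite -(mlead_deg f0) ltnS !mulr2n; move: (mdeg mon) (mdeg (mlead f)) => a b; lia.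
Qed.

Local Notation K := (koszul F m).

(** The odd generator of an edge has quantum degree 1 - n. *)
Fixpoint filtered (d : int) k : K k -> Prop :=
  match k with
  | 0 => fun y => degree_le y d
  | k'.+1 => fun y => filtered d y.1 /\ filtered (d - (1 - n%:Z)) y.2
  end.

Lemma filtered_trans d e k (y : K k) : d <= e -> filtered d y -> filtered e y.
Proof.
elim: k d e y => [|k IH] d e y de /=; first by move=> H; exact: degree_le_trans de.
by case=> /IH-/(_ _ de) ? /IH H; split=> //; apply: H; rewrite lerD2r.
Qed.

Lemma filtered0 d k : filtered d (0 : K k).
Proof. by elim: k d => [|k IH] d; [exact: degree_le0 | split; apply: IH]. Qed.

Lemma filteredD d k (y z : K k) : filtered d y -> filtered d z -> filtered d (y + z).
Proof.
elim: k d y z => [|k IH] d y z; first exact: degree_leD.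
by move=> [y1 y2] [z1 z2]; split; apply: IH.
Qed.

Lemma filteredZ d e c k (y : K k) : degree_le c e -> filtered d y -> filtered (d + e) (c *: y).
Proof.
move=> ce; elim: k d y => [|k IH] d y; first by rewrite addrC; exact: degree_leM.
by move=> [y1 y2]; split; [apply: IH | rewrite addrAC; apply: IH].
Qed.

Lemma filteredN d k (y : K k) : filtered d y -> filtered d (- y).
Proof.
move=> H; rewrite -scaleN1r -[d]addr0; apply: filteredZ => //.
exact/degree_leN/(@degree_le_nat 1).
Qed.

Lemma filtered_div d i j k (y : K k) : i != j ->
  filtered (d + 2) ((X i - X j) *: y) -> filtered d y.
Proof.
move=> ij; elim: k d y => [|k IH] d y; first exact: degree_le_div.
by move=> [/IH y1 H2]; split=> //; apply: IH; rewrite addrAC.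
Qed.

Lemma filtered_coordinate d fl k (y : K k) : size fl = k -> filtered d y ->
  degree_le (coordinate fl y) (d - (1 - n%:Z) *+ count id fl).
Proof.
elim: k d fl y => [|k IH] d [|f fl] //= y; first by rewrite mulr0n subr0.
case=> sf [y1 y2]; case: f => /=; last by rewrite add0n; apply: IH.
by rewrite add1n mulrS opprD addrA; apply: IH.
Qed.

Lemma filtered_kd (s : 'I_m -> 'I_m) d l (y : K (size l)) : filtered d y ->
  filtered (d + n%:Z + 1) (kd n (fun k => X (s k)) y).
Proof.
elim: l d y => [|[j i] l IH] d y; first by move=> _; exact: degree_le0.
case=> y1 y2; split.
  apply: filteredD; last exact: IH.
  have db : degree_le (X (s i) - X (s j)) 2.
    by apply: degree_leD; [|apply: degree_leN]; apply: degree_leX.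
  by apply: filtered_trans (filteredZ db y2); lia.
apply: filteredD.
  by apply: filtered_trans (filteredZ (@degree_le_pquot _ _) y1); lia.
apply: filteredN; apply: filtered_trans (IH _ _ y2); lia.
Qed.

End Degree.

(** * The homology of the oriented resolution *)

Section Contraction.
Variables (F : fieldType) (n m : nat).
Local Notation A := {mpoly F[m]}.
Local Notation X i := ('X_i : A).
Local Notation K := (koszul F m).
Local Notation kd := (@kd F n m).
Local Notation p := (potential n).
Hypothesis n_gt0 : (0 < n)%N.
Hypothesis charF : forall k, k.+1%:R != 0 :> F.

Definition rooted (rho : 'I_m -> 'I_m) (l : seq ('I_m * 'I_m)) :=
  uniq (sources l) /\ {in sources l, forall j, rho j = j}.

Lemma rooted_contract rho j i l : rooted rho ((j, i) :: l) -> rooted (contract rho j i) l.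
Proof.
case=> /= /andP[jl ul] rl; split=> // k kl.
rewrite /contract rl ?inE ?kl ?orbT //; case: eqP => // kj.
by rewrite kj (negPf jl) in kl.
Qed.

(** The evaluation of the variables after contraction: a representative that
    is the source of no remaining edge belongs to a closed circle, and has
    been specialized to c. *)
Definition value (c : F) (rho : 'I_m -> 'I_m) l k : A :=
  if rho k \in sources l then X (rho k) else c%:MP.

Lemma pquot_diag_neq0 (k : 'I_m) : pquot n (X k) (X k) != 0.
Proof.
rewrite pquot_diag; apply/eqP => /(congr1 (meval (fun=> 0))).
rewrite meval0 mevalM mevalB meval1 (rmorphXn (meval _)) rmorph_nat /= mevalXU.
move/eqP; rewrite expr0n (gtn_eqF n_gt0) sub0r mulrN1 oppr_eq0.
by rewrite (negPf (charF n)).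
Qed.

Section Step.
Variables (rho : 'I_m -> 'I_m) (j i : 'I_m) (l : seq ('I_m * 'I_m)).
Hypothesis R : rooted rho ((j, i) :: l).

Lemma rho_source : rho j = j.
Proof. by apply: (proj2 R); rewrite inE eqxx. Qed.

Lemma source_notin : j \notin sources l.
Proof. by case: R => /andP[]. Qed.

Variable c : F.
Local Notation s := (value c rho ((j, i) :: l)).

Definition replacement : A := if rho i == j then c%:MP else s i.
Definition eliminate k : A := if k == j then replacement else X k.

Lemma value_source : s j = X j.
Proof. by rewrite /value rho_source inE eqxx. Qed.

Lemma eliminate_value k : subst eliminate (s k) = value c (contract rho j i) l k.
Proof.
rewrite /value; have [kj|kj] := eqVneq (rho k) j.
  have -> : contract rho j i k = rho i by rewrite /contract kj eqxx.
  rewrite kj inE eqxx substX /eliminate eqxx /replacement /value inE.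
  have [ij|ij] := eqVneq (rho i) j; last by [].
  by rewrite ij (negPf source_notin).
have -> : contract rho j i k = rho k by rewrite /contract (negPf kj).
rewrite inE (negPf kj) /=; case: ifP => _; last by rewrite substC.
by rewrite substX /eliminate (negPf kj).
Qed.

Lemma eliminate_replacement : subst eliminate replacement = replacement.
Proof.
rewrite /replacement; have [ij|ij] := eqVneq (rho i) j; first by rewrite substC.
rewrite /value inE (negPf ij) /=; case: ifP => _; last by rewrite substC.
by rewrite substX /eliminate (negPf ij).
Qed.

Lemma eliminateE k : subst eliminate (X k) = eliminate k.
Proof. exact: substX. Qed.

Lemma eliminate_idem x : subst eliminate (subst eliminate x) = subst eliminate x.
Proof.
rewrite subst_comp; apply: eq_subst => k.
have [->|kj] := eqVneq k j; last by rewrite {2 3}/eliminate (negPf kj) eliminateE /eliminate (negPf kj).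
by rewrite [eliminate j]/eliminate eqxx eliminate_replacement.
Qed.

Lemma eliminate_ends : subst eliminate (s i) = subst eliminate (s j).
Proof.
rewrite value_source eliminateE [eliminate j]/eliminate eqxx.
have [ij|ij] := eqVneq (rho i) j.
  by rewrite /value ij inE eqxx eliminateE /eliminate eqxx.
by rewrite -eliminate_replacement /replacement (negPf ij).
Qed.

Lemma edge_potential_step : edge_potential n s ((j, i) :: l) = 0 ->
  edge_potential n (value c (contract rho j i) l) l = 0.
Proof.
move/(congr1 (subst eliminate)); rewrite /edge_potential big_cons /= rmorph0 rmorphD rmorphB.
rewrite !rmorph_potential [GRing.RMorphism.sort _ _]/= -!/(subst _ _) eliminate_ends.
rewrite subrr add0r rmorph_sum => W0; rewrite -[RHS]W0 /edge_potential.
by apply: eq_bigr => e _; rewrite rmorphB !rmorph_potential /= !eliminate_value.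
Qed.

Lemma specialize_step x :
  subst (fun k => if k \in sources l then c%:MP else X k) (subst eliminate x) =
  subst (fun k => if k \in sources ((j, i) :: l) then c%:MP else X k) x.
Proof.
rewrite subst_comp; apply: eq_subst => k; rewrite /eliminate inE.
case: (eqVneq k j) => [->|kj] /=; last by rewrite substX.
rewrite /replacement; have [ij|ij] := eqVneq (rho i) j; first by rewrite substC.
rewrite /value inE (negPf ij) /=; case: ifP => ijl; last by rewrite substC.
by rewrite substX ijl.
Qed.

Lemma eliminate_idems (r : seq 'I_m) : {subset r <= sources l} ->
  subst eliminate (\prod_(k <- r) idem n c (X k)) = \prod_(k <- r) idem n c (X k).
Proof.
move=> rl; rewrite rmorph_prod; apply: eq_big_seq => k /rl kl /=.
rewrite subst_idem substX /eliminate; case: eqP => // kj.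
by rewrite kj (negPf source_notin) in kl.
Qed.

End Step.

(** Each edge is a Koszul factor (a, b).  If its ends have different
    representatives, then b is a nonzero linear form, and a cycle is determined
    by its first component, a cycle over the quotient by b.  Otherwise b = 0,
    a is p' at the source x, and multiplying by the idempotent at c turns a
    boundary modulo x - c into a boundary modulo a. *)
Lemma cycle_boundary c rho l (y : K (size l)) : c ^+ n = 1 -> rooted rho l ->
  let s := value c rho l in
  edge_potential n s l = 0 -> kd s y = 0 ->
  subst (fun k => if k \in sources l then c%:MP else X k)
    (coordinate (closing rho l) y) = 0 ->
  exists w, (\prod_(k <- closing_sources rho l) idem n c (X k)) *: y = kd s w.
Proof.
move=> cn; elim: l rho y => [|[j i] l IH] rho y R s W0 dy y0.
  exists 0; rewrite /closing_sources big_nil scale1r /=.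
  by move: y0; rewrite /= subst_id.
pose rho' := contract rho j i; pose s' := value c rho' l.
pose f : {rmorphism A -> A} := subst (eliminate rho j i l c).
pose e' : A := \prod_(k <- closing_sources rho' l) idem n c (X k).
have R' := rooted_contract R.
have W' : edge_potential n s' l = 0 by exact: edge_potential_step.
have fs k : f (s k) = s' k by exact: eliminate_value.
have ff x : f (f x) = f x by exact: eliminate_idem.
have fs' k : f (s' k) = s' k by rewrite -fs ff.
have fe : f e' = e'.
  by apply: eliminate_idems => // k; exact: mem_mask.
have Wl : edge_potential n s l = - (p (s i) - p (s j)).
  by apply/eqP; rewrite -addr_eq0 addrC -W0 /edge_potential big_cons.
have lift (u : K (size l)) : kd s' (kmap f u) = 0 ->
    subst (fun k => if k \in sources l then c%:MP else X k)
      (coordinate (closing rho' l) (kmap f u)) = 0 ->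
    exists w v, e' *: u - kd s w = (replacement rho j i l c - X j) *: v.
  move=> du u0; have [w Hw] := IH rho' (kmap f u) R' W' du u0.
  have [v Hv] := kmap_subst_divides j (replacement rho j i l c) (e' *: u - kd s (kmap f w)).
  exists (kmap f w), v; rewrite -Hv -[LHS]subr0; congr (_ - _); apply/esym.
  rewrite kmapB kmapZ (kmap_kd (f := f) _ _ fs) (kmap_comp _ ff).
  rewrite -(kmap_kd (f := f) _ _ fs') -Hw kmapZ (kmap_comp _ ff).
  by rewrite fe subrr.
have cond0 : subst (fun k => if k \in sources l then c%:MP else X k)
    (coordinate (closing rho' l) (kmap f (if rho i == j then y.2 else y.1))) = 0.
  by rewrite coordinate_kmap [f _]/(subst _ _) specialize_step.
have sj : s j = X j by exact: value_source.
have sij : rho i = j -> s i = s j by move=> ij; rewrite /s /value ij (rho_source R).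
have sr : rho i != j -> replacement rho j i l c = s i.
  by move=> ij; rewrite /replacement (negPf ij).
have fends : f (s i) = f (s j) by exact: eliminate_ends.
have b0 : rho i != j -> s i - X j != 0.
  move=> ij; rewrite /s /value; case: ifP => _; first exact: X_neq.
  apply/eqP => /(congr1 (meval (fun=> c + 1))) /eqP.
  by rewrite mevalB mevalC mevalXU meval0 opprD addNKr oppr_eq0 oner_eq0.
clearbody s s'.
case: y dy cond0 {y0} => [u v] [d1 d2].
rewrite /closing_sources /=; case: eqP => [ij|/eqP ij] /=; rewrite -/(closing_sources rho' l).
  have {}sij := sij ij.
  have tE : replacement rho j i l c = c%:MP by rewrite /replacement ij eqxx.
  move: d1 d2; rewrite sij subrr scale0r add0r sj => d1 d2 y0.
  set a := pquot n (X j) (X j) in d2 *.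
  have a0 : a != 0 by exact: pquot_diag_neq0.
  have fX : f (X j) = c%:MP by rewrite /f /= substX /eliminate eqxx.
  have dv : kd s v = a *: u by apply/esym/eqP; rewrite -subr_eq0 d2.
  have [|w [v' Hv]] := lift v _ y0.
    rewrite -(kmap_kd (f := f) _ _ fs) dv kmapZ rmorph_pquot fX pquot_diag.
    by rewrite -rmorphXn cn rmorph1 subrr mulr0 scale0r.
  pose L := idem n c (X j); pose ka : A := (c / n%:R / n.+1%:R)%:MP.
  have HL : L * (X j - c%:MP) = ka * a by exact: idem_mul.
  rewrite big_cons -/e' -/L.
  have Hv2 : (L * e') *: v = L *: kd s w - (ka * a) *: v'.
    rewrite -scalerA -(subrK (kd s w) (e' *: v)) Hv tE scalerDr scalerA addrC.
    by rewrite -HL -scaleNr -mulrN opprB.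
  exists (- (ka *: v'), - (L *: w)).
  apply: (@pair_eqP F m (size l)); rewrite /= ?scale0r ?add0r.
    apply/eqP; rewrite -subr_eq0 -(scaleN1r (ka *: v')) !kdZ scaleN1r opprK; apply/eqP.
    apply: (koszul_torsion_free a0).
    have : kd s ((L * e') *: v) = kd s (L *: kd s w - (ka * a) *: v') by rewrite Hv2.
    rewrite kdB !kdZ kd_square Wl sij subrr oppr0 scale0r scaler0 sub0r dv => H.
    by rewrite scalerA in H; rewrite scalerDr !scalerA ![a * _]mulrC H addNr.
  by rewrite Hv2 -(scaleN1r (L *: w)) !kdZ scaleN1r opprK scalerN scalerA mulrC addrC.
have tE := sr ij; have {}b0 := b0 ij.
rewrite sj in d1 d2; move=> y0.
have du : kd s u = - ((s i - X j) *: v) by apply/eqP; rewrite -addr_eq0 addrC d1.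
have dv : kd s v = pquot n (s i) (X j) *: u by apply/esym/eqP; rewrite -subr_eq0 d2.
have [|w [v' Hv]] := lift u _ y0.
  rewrite -(kmap_kd (f := f) _ _ fs) du -scaleNr kmapZ rmorphN rmorphB.
  have -> : f (s i) = f (X j) by rewrite -sj.
  by rewrite subrr oppr0 scale0r.
rewrite tE in Hv; rewrite -/e'; exists (w, v').
apply: (@pair_eqP F m (size l)); rewrite /= sj; first by rewrite -Hv subrK.
apply/eqP; rewrite -subr_eq0; apply/eqP; apply: (koszul_torsion_free b0).
have : kd s (e' *: u - kd s w) = (s i - X j) *: kd s v' by rewrite Hv kdZ.
rewrite kdB kdZ kd_square Wl du pquotP sj => H.
rewrite !scalerBr -H scalerN scaleNr opprK !scalerA [e' * _]mulrC [pquot _ _ _ * _]mulrC.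
by rewrite opprB addrK subrr.
Qed.

End Contraction.

Section TopCycle.
Variables (F : fieldType) (n m : nat).
Local Notation A := {mpoly F[m]}.
Local Notation X i := ('X_i : A).
Local Notation K := (koszul F m).
Local Notation kd := (@kd F n m).
Local Notation p := (potential n).

(** A cycle y over the quotient by b = x_i - x_j extends to a cycle (y, v) with
    b v = - d y.  Dividing by b lowers the degree by 2, and the differential raises
    it by n + 1, so the quantum degree 1 - n of the odd generator keeps v in the
    same step of the filtration.  At a closing edge (0, y) is a cycle. *)
Lemma top_cycle (rho : 'I_m -> 'I_m) l : rooted rho l ->
  edge_potential n (fun k => X (rho k)) l = 0 ->
  exists y : K (size l), [/\ kd (fun k => X (rho k)) y = 0,
    coordinate (closing rho l) y = 1 &
    filtered n ((1 - n%:Z) *+ count id (closing rho l)) y].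
Proof.
elim: l rho => [|[j i] l IH] rho R W0.
  by exists 1; split=> //; exact: (@degree_le_nat F m 1).
pose rho' := contract rho j i.
pose s k := X (rho k); pose s' k := X (rho' k).
have R' : rooted rho' l := rooted_contract R.
have rj : rho j = j := rho_source R.
have Wl : edge_potential n s l = - (p (s i) - p (s j)).
  by apply/eqP; rewrite -addr_eq0 addrC -W0 /edge_potential big_cons.
rewrite -/s /= in W0 *; case: eqP => [ij|/eqP ij] /=; rewrite -/rho'.
  have rE : rho' = rho.
    by apply/funext => k; rewrite /rho' /contract; case: eqP => // ->.
  have sij : s i = s j by rewrite /s ij rj.
  have [|y [dy y1 fy]] := IH rho' R'.
    by rewrite rE Wl sij subrr oppr0.
  exists (0, y); rewrite rE in dy y1 fy *; split=> /=.
  - by apply: (@pair_eqP F m (size l)); rewrite /= ?sij ?subrr ?scale0r ?scaler0 ?kd0 ?dy ?addr0 ?subr0.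
  - by [].
  split; first exact: filtered0.
  by rewrite add1n mulrS addrAC subrr add0r.
pose f : {rmorphism A -> A} := subst (fun k => if k == j then X (rho i) else X k).
have fX k : k != j -> f (X k) = X k by move=> /negPf kj; rewrite /f /= substX kj.
have fXj : f (X j) = X (rho i) by rewrite /f /= substX eqxx.
have fs k : f (s k) = s' k.
  rewrite /s /s' /rho' /contract; case: eqP => [->|/eqP kj]; first exact: fXj.
  exact: fX.
have fs' k : f (s' k) = s' k.
  by apply: fX; rewrite /rho' /contract; case: ifPn.
have fij : f (s i) = f (s j) by rewrite /s rj fXj fX.
have [|y [dy y1 fy]] := IH rho' R'.
  have := congr1 f W0; rewrite /edge_potential big_cons /= rmorph0 rmorphD rmorphB.
  rewrite !rmorph_potential fij subrr add0r rmorph_sum => H; rewrite -[RHS]H.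
  by apply: eq_bigr => e _; rewrite rmorphB !rmorph_potential !fs.
have b0 : s i - s j != 0 by rewrite X_neq // rj.
have [v Hv] := kmap_subst_divides j (X (rho i)) (kd s y).
have {}Hv : kd s y = (s i - s j) *: v.
  rewrite [s j]/s rj [s i]/s -Hv -[LHS]subr0; congr (_ - _).
  apply/esym; rewrite (kmap_kd (f := f) _ _ fs) -(_ : kmap f (kd s' y) = kd s' (kmap f y)).
    by rewrite dy kmap0.
  exact: kmap_kd.
exists (y, - v); split=> //=.
  apply: (@pair_eqP F m (size l)); rewrite /=; first by rewrite Hv scalerN addNr.
  have -> : kd s (- v) = - kd s v by rewrite -(scaleN1r v) kdZ scaleN1r.
  apply: (koszul_torsion_free b0); rewrite opprK scalerDr -kdZ -Hv.
  by rewrite kd_square Wl pquotP scalerA mulrC -scalerDl addrN scale0r.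
rewrite add0n; split=> //; apply: filteredN.
apply: (@filtered_div F n m _ (rho i) j) => //.
have <- : kd s y = (X (rho i) - X j) *: v by rewrite Hv /s rj.
apply: filtered_trans (filtered_kd rho fy).
by rewrite opprB; lia.
Qed.

End TopCycle.

(** * Counting Seifert circles *)

Section Components.
Variable m : nat.
Implicit Types (rho : 'I_m -> 'I_m) (l : seq ('I_m * 'I_m)).

Fixpoint contract_all rho l :=
  if l is (j, i) :: l' then contract_all (contract rho j i) l' else rho.

Lemma contract_all_eq rho l u v : rho u = rho v -> contract_all rho l u = contract_all rho l v.
Proof.
by elim: l rho => [|[j i] l IH] rho //= e; apply: IH; rewrite /contract e.
Qed.

Lemma contract_all_edge rho l : rooted rho l ->
  {in l, forall e, contract_all rho l e.1 = contract_all rho l e.2}.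
Proof.
elim: l rho => [|[j i] l IH] rho // R e; rewrite inE => /predU1P[->|el] /=; last first.
  exact: (IH _ (rooted_contract R)).
apply: contract_all_eq; rewrite /contract (rho_source R) eqxx.
by case: eqP.
Qed.

Lemma contract_all_connect (e : rel 'I_m) rho l : connect_sym e ->
  (forall k, connect e k (rho k)) -> {in l, forall d, e d.1 d.2} ->
  forall k, connect e k (contract_all rho l k).
Proof.
move=> se; elim: l rho => [|[j i] l IH] rho // er el k /=.
apply: IH => [k'|d dl]; last by apply: el; rewrite inE dl orbT.
rewrite /contract; case: eqP => [kj|_]; last exact: er.
apply: connect_trans (er k') _; rewrite kj; apply: connect_trans _ (er i).
by apply: connect1; apply: (el (j, i)); rewrite inE eqxx.
Qed.

Lemma card_contract_all rho l : rooted rho l ->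
  (#|[set contract_all rho l k | k in 'I_m]| + size l =
   #|[set rho k | k in 'I_m]| + count id (closing rho l))%N.
Proof.
elim: l rho => [|[j i] l IH] rho R //=.
rewrite addnS IH; last exact: rooted_contract.
case: eqP => [ij|/eqP ij] /=.
  rewrite add1n addnS; congr ((_ + _).+1)%N; congr #|pred_of_set _|.
  by apply: eq_imset => k; rewrite /contract ij; case: eqP => // ->.
rewrite add0n -addSn; congr (_ + _)%N.
rewrite [in RHS](cardsD1 j).
have -> : j \in [set rho k | k in 'I_m].
  by apply/imsetP; exists j; rewrite // (rho_source R).
rewrite add1n; congr _.+1; apply: eq_card => x; rewrite in_setD1.
apply/imsetP/andP => [[k _ ->]|[xj /imsetP[k _ xk]]].
  rewrite /contract; case: (eqVneq (rho k) j) => [_|kj].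
    by split=> //; apply/imsetP; exists i.
  by split=> //; apply/imsetP; exists k.
by exists k => //; rewrite /contract -xk (negPf xj).
Qed.

(** Contracting all edges identifies exactly the vertices of a component, and
    each edge that is not closing removes one representative. *)
Lemma components_closing l : uniq (sources l) -> size l = m ->
  components l = count id (closing id l).
Proof.
move=> ul sl; have R : rooted id l by split.
have := card_contract_all R; rewrite sl.
have -> : [set id k | k in 'I_m] = setT.
  by apply/setP => k; rewrite inE; apply/imsetP; exists k.
rewrite cardsT card_ord [RHS]addnC => /addIn <-; rewrite /components.
set e := [rel u v | _]; set g := contract_all id l.
have se : connect_sym e by apply: sym_connect_sym => u v /=; rewrite orbC.
have gc k : connect e k (g k).
  by apply: contract_all_connect => // -[u v] dl; rewrite /= dl.
have ge u v : connect e u v = (g u == g v).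
  apply/idP/eqP => [/connectP[q]|guv]; last first.
    by apply: connect_trans (gc u) _; rewrite guv se.
  elim: q u => [|w q IH] u /=; first by move=> _ ->.
  case/andP => uw wq lq; rewrite -(IH w wq lq).
  by case/orP: uw => /(contract_all_edge R).
rewrite /n_comp_mem; transitivity #|[set x | roots e x]|.
  by apply: eq_card => x; rewrite !inE andbT.
rewrite -(@card_in_imset _ _ g); last first.
  move=> x y; rewrite !inE => /eqP rx /eqP ry /eqP; rewrite -ge -root_connect //.
  by rewrite rx ry => /eqP.
apply: eq_card => x; apply/imsetP/imsetP => [[k _ ->]|[k _ ->]]; first by exists k.
exists (fingraph.root e k); first by rewrite inE roots_root.
by apply/eqP; rewrite -ge connect_root.
Qed.

End Components.

Section SeifertCircles.
Variables (m : nat) (D : seq (piece m)).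

Definition seifert_edges := flatten (map (@smoothing m) D).

Lemma sources_entrances : perm_eq (sources seifert_edges) (flatten (map (@entrances m) D)).
Proof.
rewrite /sources /seifert_edges map_flatten -map_comp; elim: D => [|pc D' IH] //=.
apply: perm_cat => //; case: pc => [j i|pos x1 x2 x3 x4] //=.
by rewrite -(perm_rcons _ [:: _]).
Qed.

Hypothesis hD : knot_diagram D.

Lemma sources_uniq : uniq (sources seifert_edges).
Proof.
case: hD => _ ent _ _ _.
by rewrite (perm_uniq sources_entrances) (perm_uniq ent) enum_uniq.
Qed.

Lemma mem_sources k : k \in sources seifert_edges.
Proof.
case: hD => _ ent _ _ _.
by rewrite (perm_mem sources_entrances) (perm_mem ent) mem_enum.
Qed.

Lemma seifert_circles_closing : seifert_circles D = count id (closing id seifert_edges).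
Proof.
apply: components_closing; first exact: sources_uniq.
case: hD => _ ent _ _ _.
by rewrite -(size_map fst) (perm_size sources_entrances) (perm_size ent) size_enum_ord.
Qed.

End SeifertCircles.

(** * The oriented resolution inside the complex of the diagram *)

Section Transfer.
Variables (F : fieldType) (n m : nat).
Local Notation A := {mpoly F[m]}.
Local Notation X i := ('X_i : A).
Local Notation C D := (diagram_complex F n D).
Local Notation V D := {ffun gens (C D) -> A}.
Local Notation K D := (koszul F m (size (seifert_edges D))).
Local Notation d0 := (@kd F n m (fun k => X k)).

Implicit Types D : seq (piece m).

Definition slice (P Q : finType) (b : P) (z : {ffun P * Q -> A}) : {ffun Q -> A} :=
  [ffun c => z (b, c)].

Lemma slice_kapp (P Q : finType) (M : P -> P -> A) eps (N : Q -> Q -> A) b z :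
  slice b (kapp (tensor_kernel M eps N) z) =
  \sum_c sc (M b c) (slice c z) + sc (eps b) (kapp N (slice b z)).
Proof.
apply/ffunP => t; rewrite !ffunE sum_ffunE /tensor_kernel /=.
rewrite (eq_bigr (fun s => (M b s.1 * (t == s.2)%:R +
  eps s.1 * (b == s.1)%:R * N t s.2) * z (s.1, s.2))); last by case.
rewrite -(pair_bigA _ (fun s1 s2 =>
  (M b s1 * (t == s2)%:R + eps s1 * (b == s1)%:R * N t s2) * z (s1, s2))) /=.
rewrite mulr_sumr; under eq_bigr => s1 _.
  rewrite (eq_bigr (fun s2 => (t == s2)%:R * (M b s1 * z (s1, s2)) +
    (b == s1)%:R * (eps s1 * (N t s2 * z (s1, s2))))); last by move=> s2 _; ring.
  rewrite big_split /= sum_deltal -mulr_sumr; over.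
rewrite big_split /= sum_deltal; congr (_ + _); last first.
  by apply: eq_bigr => s _; rewrite !ffunE.
by apply: eq_bigr => s _; rewrite !ffunE.
Qed.

Lemma slice_sc (P Q : finType) (b : P) c (z : {ffun P * Q -> A}) : slice b (sc c z) = sc c (slice b z).
Proof. by apply/ffunP => t; rewrite !ffunE. Qed.

Lemma sliceD (P Q : finType) (b : P) (y z : {ffun P * Q -> A}) : slice b (y + z) = slice b y + slice b z.
Proof. by apply/ffunP => t; rewrite !ffunE. Qed.

(** The oriented resolution of a crossing is the tensor product of two arcs;
    the generator in which both arcs contribute their odd part carries the
    opposite sign there. *)
Fixpoint to_koszul D : V D -> K D :=
  match D return V D -> K D with
  | [::] => fun z => z tt
  | pc :: D' =>
      match pc return V (pc :: D') -> K (pc :: D') with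
      | Arc j i => fun z =>
          (to_koszul (D := D') (slice false z),
           to_koszul (D := D') (slice true z))
      | Crossing pos x1 x2 x3 x4 => fun z =>
          let r e k := to_koszul (D := D') (slice (false, e, k) z) in
          ((r false 0, r true 1), (r true 0, - r false 1))
      end
  end.

Fixpoint of_koszul D : K D -> V D :=
  match D return K D -> V D with
  | [::] => fun y => [ffun=> y]
  | pc :: D' =>
      match pc return K (pc :: D') -> V (pc :: D') with
      | Arc j i => fun y =>
          [ffun b => of_koszul (D := D') (if b.1 then y.2 else y.1) b.2]
      | Crossing pos x1 x2 x3 x4 => fun y =>
          [ffun b => if b.1.1.1 then 0 else
             of_koszul (D := D')
               (if b.1.1.2 then (if b.1.2 == 0 then y.2.1 else y.1.2)
                else (if b.1.2 == 0 then y.1.1 else - y.2.2)) b.2]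
      end
  end.

Definition oriented D (b : gens (C D)) := ~~ has id (resolution b).

Lemma to_koszulD D (y z : V D) : to_koszul (y + z) = to_koszul y + to_koszul z.
Proof.
elim: D y z => [|[j i|pos x1 x2 x3 x4] D IH] y z /=; first by rewrite ffunE.
  by rewrite !sliceD !IH.
by rewrite !sliceD !IH opprD.
Qed.

Lemma to_koszulZ D c (y : V D) : to_koszul (sc c y) = c *: to_koszul y.
Proof.
elim: D y => [|[j i|pos x1 x2 x3 x4] D IH] y /=; first by rewrite ffunE.
  by rewrite !slice_sc !IH.
by rewrite !slice_sc !IH -scalerN.
Qed.

Lemma to_koszul_sum D I (r : seq I) (f : I -> V D) :
  to_koszul (\sum_(i <- r) f i) = \sum_(i <- r) to_koszul (f i).
Proof.
elim: r => [|i r IH]; last by rewrite !big_cons to_koszulD IH.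
by rewrite !big_nil -(sc0 0) to_koszulZ scale0r.
Qed.

Lemma to_koszul_slice pc D (b : gens (piece_complex F n pc)) (z : V (pc :: D)) :
  (forall y : V D, to_koszul (kapp (@dmf _ (C D)) y) = d0 (to_koszul y)) ->
  to_koszul (D := D) (slice b (kapp (@dmf _ (C (pc :: D))) z)) =
  \sum_c dmf b c *: to_koszul (D := D) (slice c z) + psign b *: d0 (to_koszul (D := D) (slice b z)).
Proof.
move=> IH; rewrite dmf_cons slice_kapp to_koszulD to_koszulZ IH to_koszul_sum.
by congr (_ + _); apply: eq_bigr => c _; rewrite to_koszulZ.
Qed.

Lemma to_koszul_dmf D (z : V D) : all (@distinct_ends m) D ->
  to_koszul (kapp (@dmf _ (C D)) z) = d0 (to_koszul z).
Proof.
elim: D z => [|pc D IH] z; first by move=> _ /=; rewrite ffunE big1 // => s _; rewrite mul0r.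
case/andP => gp gD; have {}IH y := IH y gD.
have S (b : gens (piece_complex F n pc)) := to_koszul_slice b z IH.
case: pc gp z S => [j i|pos x1 x2 x3 x4] gp z S.
  have ij : i != j by move: gp; rewrite /distinct_ends /= inE eq_sym andbT.
  apply: (@pair_eqP F m (size (seifert_edges D))).
    transitivity (to_koszul (D := D) (slice false (kapp (@dmf _ (C (Arc j i :: D))) z))); first by [].
    by rewrite S big_bool /= scale0r addr0 /psign expr0 scale1r.
  transitivity (to_koszul (D := D) (slice true (kapp (@dmf _ (C (Arc j i :: D))) z))); first by [].
  by rewrite S big_bool /= scale0r add0r /psign expr1 scaleN1r pi_E.
have [/andP[_ n14] /andP[n23 _]] : (true && (x1 != x4)) /\ ((x2 != x3) && true).
  by have := good_crossing gp; rewrite /= !inE !negb_or => /and4P[/and3P[_ _ ->] /andP[-> _]].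
have {}S e k : to_koszul (D := D) (slice (false, e, k) (kapp (@dmf _ (C (Crossing pos x1 x2 x3 x4 :: D))) z)) =
  Pmx F n x1 x2 x3 x4 (~~ e) k 0 *: to_koszul (D := D) (slice (false, ~~ e, 0) z) +
  Pmx F n x1 x2 x3 x4 (~~ e) k 1 *: to_koszul (D := D) (slice (false, ~~ e, 1) z) +
  (-1) ^+ e *: d0 (to_koszul (D := D) (slice (false, e, k) z)).
  rewrite S sum_cross sum2 /psign /=; congr (_ + _).
  by case: e; rewrite /= !scale0r !addr0 ?add0r.
rewrite /Pmx /= in S.
have S00 := S false 0; have S01 := S false 1; have S10 := S true 0; have S11 := S true 1.
rewrite !mx22E /= expr0 scale1r in S00 S01; rewrite !mx22E /= expr1 scaleN1r in S10 S11.
apply: (@pair_eqP F m (size (seifert_edges D)).+1);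
  apply: (@pair_eqP F m (size (seifert_edges D))).
- by rewrite [LHS]S00 [RHS]/= -addrA; congr (_ + _).
- rewrite [LHS]S11 [RHS]/= pi_E // ?scaleN1r scalerN -scaleNr opprB.
  by rewrite [RHS]addrCA addrA.
- by rewrite [LHS]S10 [RHS]/= pi_E // ?scaleN1r scalerN opprD opprK addrA.
rewrite [LHS]/= S01 [RHS]/= !pi_E //.
have -> : d0 (- to_koszul (D := D) (slice (false, false, 1) z)) =
  - d0 (to_koszul (D := D) (slice (false, false, 1) z)) by rewrite -scaleN1r kdZ scaleN1r.
by rewrite ?scale1r scaleNr !opprD !opprK addrA [Y in Y + _ = _]addrC.
Qed.

Lemma oriented_cons pc D (b : gens (C (pc :: D))) :
  oriented b = ~~ piece_res b.1 && oriented b.2.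
Proof. by rewrite /oriented /= negb_or. Qed.

Lemma of_koszulK D (y : K D) : to_koszul (of_koszul y) = y.
Proof.
elim: D y => [|[j i|pos x1 x2 x3 x4] D IH] y; first by rewrite /= ffunE.
  have S b : slice b (of_koszul (D := Arc j i :: D) y) = of_koszul (D := D) (if b then y.2 else y.1).
    by apply/ffunP => t; rewrite !ffunE.
  by apply: (@pair_eqP F m (size (seifert_edges D))); rewrite /= S IH.
have S e k : slice (false, e, k) (of_koszul (D := Crossing pos x1 x2 x3 x4 :: D) y) =
    of_koszul (D := D) (if e then (if k == 0 then y.2.1 else y.1.2)
      else (if k == 0 then y.1.1 else - y.2.2)).
  by apply/ffunP => t; rewrite !ffunE.
apply: (@pair_eqP F m (size (seifert_edges D)).+1);
  by apply: (@pair_eqP F m (size (seifert_edges D))); rewrite /= S IH ?opprK.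
Qed.

Lemma of_koszulN D (y : K D) : of_koszul (- y) = - of_koszul y.
Proof.
elim: D y => [|[j i|pos x1 x2 x3 x4] D IH] y; apply/ffunP => b; rewrite !ffunE //.
  pose w : K D := if b.1 then y.2 else y.1.
  transitivity (of_koszul (D := D) (- w) b.2); first by rewrite /w; case: b.1.
  by rewrite IH ffunE.
case: ifP => _; first by rewrite oppr0.
pose w : K D := if b.1.1.2 then (if b.1.2 == 0 then y.2.1 else y.1.2)
  else (if b.1.2 == 0 then y.1.1 else - y.2.2).
transitivity (of_koszul (D := D) (- w) b.2); last by rewrite IH ffunE.
by rewrite /w; case: ifP => _; case: ifP.
Qed.

Lemma to_koszulK D (z : V D) : of_koszul (to_koszul z) = msk (@oriented D) z.
Proof.
elim: D z => [|[j i|pos x1 x2 x3 x4] D IH] z; apply/ffunP => b.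
- by rewrite !ffunE /oriented /= mul1r; case: b.
- case: b => [e b]; rewrite [LHS]ffunE [RHS]ffunE oriented_cons /=.
  transitivity (of_koszul (D := D) (to_koszul (D := D) (slice e z)) b).
    by case: e.
  by rewrite IH !ffunE.
case: b => [[[G e] k] b]; rewrite [LHS]ffunE [RHS]ffunE oriented_cons /=.
case: G; first by rewrite mul0r.
transitivity (of_koszul (D := D) (to_koszul (D := D) (slice (false, e, k) z)) b).
  by have [->|->] := ord2P k; case: e; rewrite /= ?opprK.
by rewrite IH !ffunE.
Qed.

End Transfer.

Section TransferProperties.
Variables (F : fieldType) (n m : nat).
Local Notation A := {mpoly F[m]}.
Local Notation X i := ('X_i : A).
Local Notation p := (potential n).
Local Notation C D := (diagram_complex F n D).
Local Notation V D := {ffun gens (C D) -> A}.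
Local Notation K D := (koszul F m (size (seifert_edges D))).
Local Notation d0 := (@kd F n m (fun k => X k)).
Implicit Types D : seq (piece m).

Lemma oriented_dmf D (t s : gens (C D)) : oriented t != oriented s -> dmf t s = 0.
Proof.
by move=> ne; apply: dmf_resolution; apply: contraNneq ne; rewrite /oriented => ->.
Qed.

Lemma msk_of_koszul D (y : K D) : msk (@oriented F n m D) (of_koszul n y) = of_koszul n y.
Proof. by rewrite -to_koszulK of_koszulK. Qed.

Lemma of_koszul_msk D (z : V D) : to_koszul (msk (@oriented F n m D) z) = to_koszul z.
Proof. by rewrite -to_koszulK of_koszulK. Qed.

Lemma of_koszulZ D c (y : K D) : of_koszul n (c *: y) = sc c (of_koszul n y).
Proof.
by rewrite -{1}[y](of_koszulK n) -to_koszulZ to_koszulK msk_sc msk_of_koszul.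
Qed.

Lemma of_koszulD D (y z : K D) : of_koszul n (y + z) = of_koszul n y + of_koszul n z.
Proof.
by rewrite -{1}[y](of_koszulK n) -{1}[z](of_koszulK n) -to_koszulD to_koszulK [LHS]dgD -!/(msk _ _)
  !msk_of_koszul.
Qed.

Lemma of_koszul_dmf D (y : K D) : all (@distinct_ends m) D ->
  kapp (@dmf _ (C D)) (of_koszul n y) = of_koszul n (d0 y).
Proof.
move=> gD; rewrite -{2}[y](of_koszulK n) -to_koszul_dmf // to_koszulK -kapp_msk ?msk_of_koszul //.
exact: oriented_dmf.
Qed.

Lemma edge_potentialE D : edge_potential n (fun k => X k) (seifert_edges D) =
  \sum_(pc <- D) piece_potential F n pc.
Proof.
elim: D => [|pc D IH]; first by rewrite /edge_potential !big_nil.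
rewrite /edge_potential /seifert_edges /= big_cat big_cons; congr (_ + _); last exact: IH.
case: pc => [j i|pos x1 x2 x3 x4]; rewrite /piece_potential /= !big_cons !big_nil /=; ring.
Qed.

Lemma sum_wpc D : knot_diagram D -> \sum_(pc <- D) piece_potential F n pc = 0.
Proof.
case=> _ ent ext _ _; rewrite /piece_potential sumrB.
have E (f : piece m -> seq 'I_m) : \sum_(pc <- D) \sum_(i <- f pc) p (X i) =
    \sum_(i <- flatten (map f D)) p (X i) by rewrite big_flatten big_map.
by rewrite !E (perm_big _ ent) (perm_big _ ext) subrr.
Qed.

Lemma to_koszul_filtered D (z : V D) d :
  (forall b, degree_le (z b) (d + (n%:Z - 1) * writhe D - qdeg b)) ->
  filtered n d (to_koszul z).
Proof.
elim: D z d => [|[j i|pos x1 x2 x3 x4] D IH] z d H.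
- move=> mon Hmon; have := H tt mon Hmon; rewrite /writhe big_nil /= mulr0; lia.
- split; apply: IH => b; rewrite ffunE.
    apply: degree_le_trans (H (false, b)) _.
    by rewrite /writhe big_cons /=; lia.
  apply: degree_le_trans (H (true, b)) _.
  by rewrite /writhe big_cons /=; lia.
have H' e k (b : gens (C D)) : degree_le (z (false, e, k, b))
    (d + (n%:Z - 1) * writhe D - ((if ~~ e then (if k == 0 then 0 else 2 - n%:Z *+ 2)
      else 1 - n%:Z) + qdeg b)).
  apply: degree_le_trans (H (false, e, k, b)) _.
  by rewrite /writhe big_cons /=; clear; case: (pos); case: (e); case: ifP; lia.
split; split; try apply: filteredN; apply: IH => b; rewrite ffunE;
  apply: degree_le_trans (H' _ _ b) _ => /=; lia.
Qed.

Lemma of_koszul_filtered D (y : K D) d : filtered n d y ->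
  forall b, degree_le (of_koszul n y b) (d + (n%:Z - 1) * writhe D - qdeg b).
Proof.
elim: D y d => [|[j i|pos x1 x2 x3 x4] D IH] y d H b.
- move=> mon; rewrite ffunE => Hmon; have := H mon Hmon; rewrite /writhe big_nil /= mulr0; lia.
- case: b => [e b]; rewrite ffunE /=; case: H => H0 H1.
  case: e; apply: degree_le_trans (IH _ _ _ b) _; try eassumption;
    rewrite /writhe big_cons /=; lia.
case: b => [[[G e] k] b]; rewrite ffunE /=; case: G => /=; first exact: degree_le0.
case: H => [[H00 H01] [H10 /filteredN H11]].
case: e; case: ifP => _; apply: degree_le_trans (IH _ _ _ b) _; try eassumption;
    rewrite /writhe big_cons /=; clear; case: (pos); lia.
Qed.

End TransferProperties.

Lemma flatten_split (T : Type) (S : eqType) (f : T -> seq S) (x : S) (D : seq T) :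
  x \in flatten (map f D) -> exists D1 pc D2, D = D1 ++ pc :: D2 /\ x \in f pc.
Proof.
elim: D => [|pc D IH] //=; rewrite mem_cat => /orP[xf|/IH[D1 [pc' [D2 [-> xf]]]]].
  by exists [::], pc, D.
by exists (pc :: D1), pc', D2.
Qed.

(** * States *)

Section Derivative.
Variables (F : fieldType) (n m : nat).
Local Notation A := {mpoly F[m]}.
Local Notation X i := ('X_i : A).

Lemma mderiv_X (k i : 'I_m) : (X i)^`M(k) = (i == k)%:R.
Proof.
rewrite mderivX mnm1E; case: eqVneq => [->|_]; last by rewrite scale0r.
have -> : (U_(k) - U_(k) = 0 :> 'X_{1..m})%MM by apply/mnmP => l; rewrite mnmBE subnn mnm0E.
by rewrite mpolyX0 scale1r.
Qed.

Lemma mderiv_exp (k : 'I_m) (f : A) j : (f ^+ j.+1)^`M(k) = j.+1%:R * f ^+ j * f^`M(k).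
Proof.
elim: j => [|j IH]; first by rewrite expr1 mulr1 mul1r.
rewrite exprS mderivM IH !exprS -[j.+2]addn1 natrD; ring.
Qed.

Lemma mderiv_potential (k i : 'I_m) :
  (potential n (X i))^`M(k) = (i == k)%:R * (n.+1%:R * (X i ^+ n - 1)).
Proof.
have lin : (n.+1%:R * X i)^`M(k) = n.+1%:R * (i == k)%:R.
  have <- : (n.+1%:R)%:MP_[m] = n.+1%:R :> A by exact: (rmorph_nat (@mpolyC m F)).
  by rewrite mderiv_mulC mderiv_X.
by rewrite /potential mderivB lin mderiv_exp mderiv_X; ring.
Qed.

Lemma mderiv_wpc pc k : distinct_ends pc -> k \in exits pc ->
  (piece_potential F n pc)^`M(k) = n.+1%:R * (X k ^+ n - 1).
Proof.
rewrite /distinct_ends cat_uniq => /and3P[_ /hasPn dis ux] kx.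
have S (r : seq 'I_m) : (\sum_(i <- r) potential n (X i))^`M(k) =
    \sum_(i <- r) (i == k)%:R * (n.+1%:R * (X k ^+ n - 1)).
  rewrite raddf_sum /=; apply: eq_bigr => i _; rewrite mderiv_potential.
  by case: eqVneq => [->|_]; rewrite ?mul0r.
rewrite /piece_potential mderivB !S (bigD1_seq k) //= eqxx mul1r big1 => [|i /negPf ->]; last by rewrite mul0r.
rewrite big1_seq ?subr0 ?addr0 // => i /= ie; case: eqVneq => [ik|_]; last by rewrite mul0r.
by have := dis k kx; rewrite -ik ie.
Qed.

End Derivative.

Section Homotopies.
Variables (F : fieldType) (n m : nat) (D : seq (piece m)).
Local Notation A := {mpoly F[m]}.
Local Notation X i := ('X_i : A).
Local Notation p := (potential n).
Local Notation C := (diagram_complex F n D).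
Local Notation V := {ffun gens C -> A}.
Local Notation dm := (kapp (@dmf _ C)).
Local Notation dx := (kapp (@dchi _ C)).
Implicit Types z : V.
Hypothesis n_gt0 : (0 < n)%N.
Hypothesis charF : forall k, k.+1%:R != 0 :> F.
Hypothesis hD : knot_diagram D.

Lemma all_good : all (@distinct_ends m) D.
Proof. by case: hD. Qed.

Lemma dm_dx z : dm (dx z) = dx (dm z).
Proof. by rewrite !kappA; apply: kapp_ext => t s; rewrite diagram_commute ?all_good. Qed.

Definition mf_boundary z := exists w, z = dm w.

Lemma mf_boundaryD z w : mf_boundary z -> mf_boundary w -> mf_boundary (z + w).
Proof. by move=> [z' ->] [w' ->]; exists (z' + w'); rewrite kappD. Qed.

Lemma mf_boundaryN z : mf_boundary z -> mf_boundary (- z).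
Proof. by move=> [z' ->]; exists (- z'); rewrite kappN. Qed.

Lemma mf_boundary_sc f z : mf_boundary z -> mf_boundary (sc f z).
Proof. by move=> [z' ->]; exists (sc f z'); rewrite kapp_sc. Qed.

Lemma mf_boundary_dx z : mf_boundary z -> mf_boundary (dx z).
Proof. by move=> [z' ->]; exists (dx z'); rewrite dm_dx. Qed.

Lemma mf_boundary0 : mf_boundary 0.
Proof. by exists 0; rewrite kapp0. Qed.

Lemma mf_boundary_sum I (r : seq I) (P : pred I) (f : I -> V) :
  (forall i, P i -> mf_boundary (f i)) -> mf_boundary (\sum_(i <- r | P i) f i).
Proof. by move=> H; apply: (big_ind mf_boundary) => //; [exact: mf_boundary0 | exact: mf_boundaryD]. Qed.

Definition annihilator z (f : A) := mf_boundary (sc f z).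

Lemma annihilator_ideal z : ideal_pred (annihilator z).
Proof.
split=> [|f g Jf Jg|c f Jf]; first by rewrite /annihilator sc0; exact: mf_boundary0.
  by rewrite /annihilator scDl; apply: mf_boundaryD.
by rewrite /annihilator -scA; apply: mf_boundary_sc.
Qed.

Definition at_position i g (s : gens C) := nth false (resolution s) i == g.

Lemma dm_msk (q : seq bool -> bool) z :
  dm (msk (fun s => q (resolution s)) z) = msk (fun s => q (resolution s)) (dm z).
Proof.
apply: kapp_msk => t s ne; apply: dmf_resolution.
by apply: contraNneq ne => ->.
Qed.

Lemma dm_position i g z :
  dm (msk (at_position i g) z) = msk (at_position i g) (dm z).
Proof. exact: (dm_msk (fun r => nth false r i == g)). Qed.

Lemma msk0 q : msk q (0 : V) = 0.
Proof. by apply/ffunP => t; rewrite !ffunE mulr0. Qed.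

Lemma annihilator_local D1 pc D2 g z w : D = D1 ++ pc :: D2 -> dm z = 0 ->
  msk (at_position (size D1) g) z = z ->
  annihilator z (polar (vec F n pc g) w).
Proof.
rewrite /annihilator /mf_boundary /at_position; move: z => z0 eD; move: z0.
have [h Hh] : exists h, forall t s, kmul (@dmf _ C) h t s + kmul h (@dmf _ C) t s =
    polar (vec F n pc (nth false (resolution s) (size D1))) w * (t == s)%:R.
  by rewrite eD; exact: diagram_null.
move=> z dz mz; exists (kapp h z); have := kapp_homotopy z Hh.
rewrite dz kapp0 addr0 => ->; rewrite -mz; apply/ffunP => t; rewrite !ffunE.
by case: eqP => [->|_]; rewrite ?mul0r ?mulr0.
Qed.

Lemma annihilator_entries D1 pc D2 g z : D = D1 ++ pc :: D2 -> dm z = 0 ->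
  msk (at_position (size D1) g) z = z ->
  let: (a1, b1, a2, b2) := vec F n pc g in
  [/\ annihilator z a1, annihilator z b1, annihilator z a2 & annihilator z b2].
Proof.
move=> eD dz mz; have loc := annihilator_local _ eD dz mz.
case: (vec F n pc g) loc => [[[a1 b1] a2] b2] loc.
have Ja1 := loc (0, 1, 0, 0); have Jb1 := loc (1, 0, 0, 0).
have Ja2 := loc (0, 0, 0, 1); have Jb2 := loc (0, 0, 1, 0).
by rewrite /= !(mulr0, mul0r, mulr1, mul1r, addr0, add0r) in Ja1 Jb1 Ja2 Jb2.
Qed.

Lemma split_position i z :
  msk (at_position i true) z + msk (at_position i false) z = z.
Proof.
apply/ffunP => t; rewrite !ffunE /at_position -mulrDl.
by case: nth; rewrite /= ?addr0 ?add0r mul1r.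
Qed.

Lemma msk_position i g z : msk (at_position i g) (msk (at_position i g) z) = msk (at_position i g) z.
Proof. by apply/ffunP => t; rewrite !ffunE; case: (at_position _ _ _); rewrite ?mul1r ?mul0r. Qed.

Lemma annihilator_split D1 pc D2 z f : D = D1 ++ pc :: D2 -> dm z = 0 ->
  (forall g z', dm z' = 0 -> msk (at_position (size D1) g) z' = z' -> annihilator z' f) ->
  annihilator z f.
Proof.
move=> eD dz H; rewrite /annihilator -(split_position (size D1) z) scD.
by apply: mf_boundaryD; [apply: (H true) | apply: (H false)]; rewrite ?msk_position ?dm_position ?dz ?msk0.
Qed.

(** Among the ends of a piece with exit k, the derivative with respect to x_k of
    the potential a1 b1 + a2 b2 is p'(x_k), and the product rule puts it in the
    ideal generated by a1, b1, a2 and b2. *)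
Lemma annihilator_unity z k : dm z = 0 -> annihilator z (X k ^+ n - 1).
Proof.
move=> dz; have kx : k \in flatten (map (@exits m) D).
  by case: hD => _ _ ext _ _; rewrite (perm_mem ext) mem_enum.
have [D1 [pc [D2 [eD kpc]]]] := flatten_split kx.
have gpc : distinct_ends pc by have := all_good; rewrite eD all_cat /= => /and3P[].
apply: (annihilator_split eD dz) => g z' dz' mz'.
have [J0 JD JM] := annihilator_ideal z'.
have loc := annihilator_entries eD dz' mz'.
suff : annihilator z' ((piece_potential F n pc)^`M(k)).
  rewrite mderiv_wpc // => /(JM (n.+1%:R^-1)%:MP); rewrite mulrA.
  have <- : (n.+1%:R)%:MP_[m] = n.+1%:R :> A by exact: (rmorph_nat (@mpolyC m F)).
  by rewrite -mpolyCM mulVf // mul1r.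
rewrite -(quad_vec F n g gpc); move: loc; case: (vec F n pc g) => [[[a1 b1] a2] b2] [Ja1 Jb1 Ja2 Jb2] /=.
rewrite mderivD !mderivM; apply: (JD); apply: (JD).
- exact: JM.
- by rewrite mulrC; exact: JM.
- exact: JM.
- by rewrite mulrC; exact: JM.
Qed.

Definition state_idem (psi : 'I_m -> F) : A := \prod_k idem n (psi k) (X k).

(** Modulo the x_k^n - 1, multiplication of the idempotent of psi by f is
    multiplication by the number f(psi). *)
Lemma state_idem_ideal (J : A -> Prop) psi f : ideal_pred J ->
  (forall k, psi k ^+ n = 1) -> (forall k, J (X k ^+ n - 1)) -> J f -> f.@[psi] != 0 ->
  J (state_idem psi).
Proof.
move=> JI pn Ju Jf f0; have [J0 JD JM] := JI.
have : J ((f - (f.@[psi])%:MP) * state_idem psi).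
  apply: ideal_eval => // k; rewrite /state_idem (bigD1 k) //= mulrA [(_ - _) * _]mulrC.
  by rewrite idem_mul // pquot_diag mulrAC !mulrA -!mulrA; apply: (JM); rewrite mulrCA mulrC -mulrA;
    apply: (JM); rewrite mulrC; apply: (JM).
move=> /(JM (-1)); rewrite mulN1r -mulNr opprB mulrBl.
have Jfe : J (f * state_idem psi) by rewrite mulrC; apply: (JM).
move/(JD _ _)/(_ Jfe); rewrite subrK => /(JM ((f.@[psi])^-1)%:MP).
by rewrite mulrA -mpolyCM mulVf // mul1r.
Qed.

(** The cycles and boundaries of the second homology, on chains. *)
Definition hp_cycle z := dm z = 0 /\ mf_boundary (dx z).
Definition hp_boundary z := exists w w', dm w = 0 /\ z = dx w + dm w'.

Lemma mf_boundary_hp z : mf_boundary z -> hp_boundary z.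
Proof. by move=> [w ->]; exists 0, w; rewrite !kapp0 add0r. Qed.

Lemma hp_boundaryD z z' : hp_boundary z -> hp_boundary z' -> hp_boundary (z + z').
Proof.
move=> [w [w' [dw ->]]] [v [v' [dv ->]]]; exists (w + v), (w' + v').
by rewrite !kappD dw dv addr0 addrACA.
Qed.

Lemma hp_boundary_sc f z : hp_boundary z -> hp_boundary (sc f z).
Proof.
move=> [w [w' [dw ->]]]; exists (sc f w), (sc f w').
by rewrite !kapp_sc dw scr0 scD.
Qed.

Lemma hp_boundary_ideal z : ideal_pred (fun f => hp_boundary (sc f z)).
Proof.
split=> [|f g Jf Jg|c f Jf]; first by rewrite sc0; apply/mf_boundary_hp/mf_boundary0.
  by rewrite scDl; apply: hp_boundaryD.
by rewrite -scA; apply: hp_boundary_sc.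
Qed.

Lemma annihilator_hp z f : annihilator z f -> hp_boundary (sc f z).
Proof. exact: mf_boundary_hp. Qed.

Lemma hp_boundary_chi D1 pos x1 x2 x3 x4 D2 z : D = D1 ++ Crossing pos x1 x2 x3 x4 :: D2 ->
  hp_cycle z -> hp_boundary (sc (X x4 - X x2) z).
Proof.
move=> eD [dz [y dxz]].
have [h [h1 h2]] : exists h : gens C -> gens C -> A,
    (forall t s, kmul (@dmf _ C) h t s = kmul h (@dmf _ C) t s) /\
    forall t s, kmul (@dchi _ C) h t s + kmul h (@dchi _ C) t s = (X x4 - X x2) * (t == s)%:R.
  have := all_good; rewrite {1}eD => /diagram_chi_homotopy; rewrite /= -eD; exact.
have hdm v : dm (kapp h v) = kapp h (dm v).
  by rewrite !kappA; apply: kapp_ext.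
exists (kapp h z), (kapp h y); split; first by rewrite hdm dz kapp0.
by rewrite hdm -dxz (kapp_homotopy z h2).
Qed.

(** Let the values differ along a strand of a crossing.  If they differ on
    x4 -> x2, then [hp_boundary_chi] applies.  If they differ on x3 -> x1 only, then
    x1 + x2 - x3 - x4 is invertible on the wide edge, and x1 - x4 or x2 - x3 is
    invertible on the oriented resolution. *)
Lemma nonconstant_state psi z : (forall k, psi k ^+ n = 1) ->
  ~~ all (fun e => psi e.1 == psi e.2) (flatten (map (@strands m) D)) ->
  hp_cycle z -> hp_boundary (sc (state_idem psi) z).
Proof.
move=> pn /allPn[[u v] uv /= puv] hz; have [dz _] := hz.
have [D1 [pc [D2 [eD uvpc]]]] := flatten_split uv.
have Ju k := annihilator_unity k dz.
case: pc eD uvpc => [j i|pos x1 x2 x3 x4] eD /=.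
  rewrite inE => /eqP[eu ev]; subst u v; apply: annihilator_hp.
  apply: (annihilator_split eD dz) => g z' dz' mz'.
  apply: (@state_idem_ideal _ _ (X i - X j)) => //; first exact: annihilator_ideal.
  - by move=> k; apply: annihilator_unity.
  - by case: (annihilator_entries eD dz' mz').
  by rewrite mevalB !mevalXU subr_eq0 eq_sym.
have [p42|p42] := eqVneq (psi x4) (psi x2); last first.
  move=> _; apply: (@state_idem_ideal (fun f => hp_boundary (sc f z)) _ (X x4 - X x2)) => //.
  - exact: hp_boundary_ideal.
  - by move=> k; apply: annihilator_hp.
  - exact: hp_boundary_chi eD hz.
  by rewrite mevalB !mevalXU subr_eq0.
rewrite !inE => /orP[/eqP[eu ev]|/eqP[eu ev]]; subst u v; first by rewrite p42 eqxx in puv.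
apply: annihilator_hp; apply: (annihilator_split eD dz) => g z' dz' mz'.
have loc := annihilator_entries eD dz' mz'.
have fin f : annihilator z' f -> f.@[psi] != 0 -> annihilator z' (state_idem psi).
  move=> Jf f0; apply: (@state_idem_ideal _ _ f) => //; first exact: annihilator_ideal.
  by move=> k; apply: annihilator_unity.
case: g loc {mz'} => /= -[_ Jb1 _ Jb2].
  apply: (fin _ Jb1); rewrite !mevalB mevalD !mevalXU p42 addrAC addrK subr_eq0 eq_sym //.
have [p14|p14] := eqVneq (psi x1) (psi x4).
  by apply: (fin _ Jb2); rewrite mevalB !mevalXU subr_eq0 -p42 -p14 eq_sym.
by apply: (fin _ Jb1); rewrite mevalB !mevalXU subr_eq0.
Qed.

End Homotopies.

Lemma n_comp1_connect (T : finType) (e : rel T) : connect_sym e -> n_comp e T = 1%N ->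
  forall u v, connect e u v.
Proof.
move=> se /eqP/card1P[r Hr] u v; rewrite -root_connect //.
have E w : fingraph.root e w = r.
  by have := Hr (fingraph.root e w); rewrite !inE roots_root //= => /esym/eqP.
by rewrite !E.
Qed.

Section ConstantStates.
Variables (F : fieldType) (n m : nat) (D : seq (piece m)).
Local Notation A := {mpoly F[m]}.
Local Notation X i := ('X_i : A).
Local Notation p := (potential n).
Local Notation C := (diagram_complex F n D).
Local Notation V := {ffun gens C -> A}.
Local Notation K := (koszul F m (size (seifert_edges D))).
Local Notation d0 := (@kd F n m (fun k => X k)).
Local Notation dm := (kapp (@dmf _ C)).
Local Notation dx := (kapp (@dchi _ C)).
Local Notation mf_boundary := (@mf_boundary F n m D).
Local Notation e_ := (@state_idem F n m).
Local Notation ori := (@oriented F n m D).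
Implicit Types z : V.
Hypothesis n_gt0 : (0 < n)%N.
Hypothesis charF : forall k, k.+1%:R != 0 :> F.
Hypothesis hD : knot_diagram D.

Lemma knot_constant (T : eqType) (psi : 'I_m -> T) :
  all (fun e => psi e.1 == psi e.2) (flatten (map (@strands m) D)) ->
  forall u v, psi u = psi v.
Proof.
move=> /allP H u v; have [_ _ _ c1 _] := hD.
have se := sym_connect_sym (e := [rel u v | ((u, v) \in flatten (map (@strands m) D)) ||
  ((v, u) \in flatten (map (@strands m) D))]).
have /connectP[q] := n_comp1_connect (se (fun u v => orbC _ _)) c1 u v.
elim: q u => [|w q IH] u /=; first by move=> _ ->.
case/andP => uw wq lq; rewrite -(IH w wq lq).
by case/orP: uw => /H /eqP.
Qed.

Lemma knot_point : exists k : 'I_m, True.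
Proof.
have [_ _ _ c1 _] := hD; have : (0 < components (flatten (map (@strands m) D)))%N by rewrite c1.
by rewrite /components /n_comp_mem => /card_gt0P[k _]; exists k.
Qed.

Lemma resolution_size (D' : seq (piece m)) (s : gens (diagram_complex F n D')) : size (resolution s) = size D'.
Proof. by elim: D' s => [|pc D' IH] s //=; rewrite IH. Qed.

Lemma resolution_arc (D1 : seq (piece m)) j i D2 (s : gens (diagram_complex F n (D1 ++ Arc j i :: D2))) :
  nth false (resolution s) (size D1) = false.
Proof. by elim: D1 s => [|pc D1 IH] s //=. Qed.

Definition first_wide_at i (s : gens C) := find id (resolution s) == i.

Lemma first_wide_at_sum z : z = msk ori z + \sum_(i < size D) msk (first_wide_at i) z.
Proof.
apply/ffunP => t; rewrite !ffunE sum_ffunE.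
under eq_bigr => i _ do rewrite ffunE.
rewrite -mulr_suml -mulrDl -[LHS]mul1r; congr (_ * _); rewrite /oriented /first_wide_at.
case: (boolP (has id _)) => [h|h]; rewrite /= ?add0r ?addr0.
  have lt : (find id (resolution t) < size D)%N by rewrite -(resolution_size t) -has_find.
  rewrite (bigD1 (Ordinal lt)) //= eqxx big1 ?addr0 // => i.
  by rewrite -val_eqE eq_sym /= => /negPf->.
rewrite big1 ?addr0 // => i _; rewrite (hasNfind h) resolution_size.
by rewrite gtn_eqF.
Qed.

(** The part of z outside the oriented resolution is split according to the first
    wide edge; on each summand u2 of that wide edge acts by zero and is
    invertible. *)
Lemma constant_state psi z : (forall u v, psi u = psi v) -> (forall k, psi k ^+ n = 1) ->
  dm z = 0 -> mf_boundary (sc (e_ psi) z - sc (e_ psi) (msk ori z)).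
Proof.
move=> pc pn dz; rewrite {1}[z]first_wide_at_sum scD addrC addKr.
rewrite (_ : sc _ _ = \sum_(i < size D) sc (e_ psi) (msk (first_wide_at i) z)); last first.
  elim/big_rec2: _ => [|i y1 y2 _ <-]; first by rewrite scr0.
  by rewrite scD.
apply: mf_boundary_sum => i _.
have dz' : dm (msk (first_wide_at i) z) = 0.
  by rewrite (dm_msk (fun r => find id r == i)) dz msk0.
have mz : msk (at_position i true) (msk (first_wide_at i) z) = msk (first_wide_at i) z.
  apply/ffunP => t; rewrite !ffunE /at_position /first_wide_at; case: (eqVneq (find id _) i) => [ft|_];
    last by rewrite mul0r mulr0.
  have h : has id (resolution t) by rewrite has_find resolution_size ft; exact: ltn_ord.
  by have := nth_find false h; rewrite ft /= => ->; rewrite !mul1r.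
have si : size (take i D) = i by rewrite size_take ltn_ord.
have [pc' [D2 eD]] : exists pc' D2, D = take i D ++ pc' :: D2.
  case Ed: (drop i D) => [|pc' D2]; last by exists pc', D2; rewrite -Ed cat_take_drop.
  by have := size_drop i D; rewrite Ed /= => /esym/eqP; rewrite subn_eq0 leqNgt ltn_ord.
case: pc' eD => [j k|pos x1 x2 x3 x4] eD.
  suff -> : msk (first_wide_at i) z = 0 by rewrite scr0; exact: mf_boundary0.
  rewrite -mz; apply/ffunP => t; rewrite !ffunE /at_position.
  suff -> : nth false (resolution t) i = false by rewrite mul0r.
  have H s : nth false (resolution (F := F) (n := n) (D := take i D ++ Arc j k :: D2) s) i = false.
    by rewrite -{2}si; exact: resolution_arc.
  by move: H; rewrite -eD.
have loc := @annihilator_entries F n m D (take i D) _ D2 true _ eD dz'.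
have U : uniq [:: x1; x2; x3; x4].
  apply: (@good_crossing m pos); have := all_good hD; rewrite {1}eD all_cat /=.
  by case/and3P.
apply: (@state_idem_ideal F n m charF (annihilator (msk (first_wide_at i) z)) psi (u2_ F n x1 x2 x3 x4)) => //.
- exact: annihilator_ideal.
- by move=> k; apply: annihilator_unity.
- by move: loc; rewrite si => /(_ mz) [].
rewrite (@meval_eq _ _ _ (fun=> psi x1)); last by move=> k; exact: pc.
rewrite u2_diag // oppr_eq0 !mulf_neq0 //; first by rewrite -(prednK n_gt0).
apply: contraTneq (oner_neq0 F) => e0.
by rewrite -(pn x1) -(prednK n_gt0) exprS e0 mulr0 eqxx.
Qed.

Local Notation fl := (closing id (seifert_edges D)).
Local Notation circles := (closing_sources id (seifert_edges D)).
(** In the homology of the oriented resolution this already acts as the idempotent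
    of psi, and its degree is small enough for the upper bound. *)
Definition circle_idem (psi : 'I_m -> F) : A := \prod_(k <- circles) idem n (psi k) (X k).

Lemma rooted_id : rooted id (seifert_edges D).
Proof. by split; first exact: sources_uniq. Qed.

Lemma edge_potential0 : edge_potential n (fun k => X k) (seifert_edges D) = 0.
Proof. by rewrite edge_potentialE sum_wpc. Qed.

Lemma koszul_null psi (y : K) : (forall u v, psi u = psi v) -> (forall k, psi k ^+ n = 1) ->
  d0 y = 0 -> (coordinate fl y).@[psi] = 0 -> exists w, circle_idem psi *: y = d0 w.
Proof.
move=> pc pn dy y0; have [k0 _] := knot_point.
have vE : value (psi k0) id (seifert_edges D) = (fun k => X k).
  by apply/funext => k; rewrite /value mem_sources.
have := @cycle_boundary F n m n_gt0 charF (psi k0) id (seifert_edges D) y (pn k0) rooted_id.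
rewrite /= vE edge_potential0 => /(_ erefl dy).
have -> : circle_idem psi = \prod_(k <- circles) idem n (psi k0) (X k).
  by rewrite /circle_idem; apply: eq_bigr => k _; rewrite (pc k k0).
apply; rewrite -[RHS](mpolyC0 m F) -y0 -subst_const; apply: eq_subst => k.
by rewrite (mem_sources hD) (pc k k0).
Qed.

Lemma generator_exists : exists y : K, [/\ d0 y = 0, coordinate fl y = 1 &
  filtered n ((1 - n%:Z) *+ seifert_circles D) y].
Proof. by rewrite seifert_circles_closing //; exact: (top_cycle rooted_id edge_potential0). Qed.

Lemma state_idem_split psi : exists r : A, e_ psi = r * circle_idem psi /\
  ((forall k, psi k ^+ n = 1) -> r.@[psi] = 1).
Proof.
have uc : uniq circles by apply: mask_uniq; exact: sources_uniq.
exists (\prod_(k | k \notin circles) idem n (psi k) (X k)); split.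
  rewrite /state_idem (bigID (mem circles)) /= mulrC; congr (_ * _).
  by rewrite /circle_idem -big_uniq.
move=> pn; rewrite rmorph_prod /= big1 // => k _.
by rewrite meval_idem mevalXU lagrange_self.
Qed.

Section Generator.
Variable y0 : K.
Hypothesis dy0 : d0 y0 = 0.
Hypothesis cy0 : coordinate fl y0 = 1.

Definition representative psi z : V :=
  of_koszul n (((coordinate fl (to_koszul z)).@[psi])%:MP *: (circle_idem psi *: y0)).

(** The difference of z and its multiple of y0 has coordinate zero at psi, so
    [koszul_null] applies to it. *)
Lemma representativeP psi z : (forall u v, psi u = psi v) -> (forall k, psi k ^+ n = 1) ->
  dm z = 0 -> mf_boundary (sc (e_ psi) z - representative psi z).
Proof.
move=> pc pn dz; rewrite -(subrK (sc (e_ psi) (msk ori z)) (sc (e_ psi) z)) -addrA.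
apply: mf_boundaryD; first exact: constant_state.
have [r [er r1]] := state_idem_split psi.
set c := (coordinate fl (to_koszul z)).@[psi]%:MP : A.
have [||w Hw] := @koszul_null psi (r *: to_koszul z - c *: y0) pc pn.
- by rewrite kdB !kdZ dy0 -to_koszul_dmf ?(all_good hD) // dz -(sc0 0) to_koszulZ scale0r !scaler0 subrr.
- rewrite coordinateD coordinateN !coordinateZ cy0 mulr1 mevalB mevalM r1 // mul1r.
  by rewrite mevalC subrr.
exists (of_koszul n w); rewrite of_koszul_dmf ?(all_good hD) // -Hw scalerBr of_koszulD of_koszulN.
congr (_ - _); last by rewrite /representative !scalerA mulrC.
by rewrite scalerA mulrC -er of_koszulZ to_koszulK.
Qed.

Lemma representative_cycle psi z : dm (representative psi z) = 0.
Proof. by rewrite /representative of_koszul_dmf ?(all_good hD) // !kdZ dy0 !scaler0 -(scale0r (0 : K)) of_koszulZ sc0. Qed.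

Lemma oriented_resolution (t s : gens C) : ori t -> ori s -> resolution t = resolution s.
Proof.
rewrite /oriented => /hasPn Ht /hasPn Hs.
have E (u : gens C) : {in resolution u, forall x, ~~ id x} -> resolution u = nseq (size D) false.
  move=> Hu; rewrite -(resolution_size u); apply/all_pred1P/allP => x /Hu /=.
  by case: x.
by rewrite (E t Ht) (E s Hs).
Qed.

Lemma msk_dx_oriented z : msk ori (dx (msk ori z)) = 0.
Proof.
apply/ffunP => t; rewrite !ffunE; case: (boolP (ori t)) => ot; last by rewrite mul0r.
rewrite mul1r big1 // => s _; rewrite ffunE; case: (boolP (ori s)) => os; last by rewrite mul0r mulr0.
by rewrite (dchi_resolution (oriented_resolution ot os)) mul0r.
Qed.

(** The second differential leaves the oriented resolution, and outside of it the
    constant states are acyclic. *)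
Lemma representative_dx psi z : (forall u v, psi u = psi v) -> (forall k, psi k ^+ n = 1) ->
  dm z = 0 -> mf_boundary (dx (representative psi z)).
Proof.
move=> pc pn dz.
have mz : dm (msk ori z) = 0 by rewrite kapp_msk ?dz ?msk0 //; exact: oriented_dmf.
have H : mf_boundary (sc (e_ psi) (dx (msk ori z))).
  have := @constant_state psi (dx (msk ori z)) pc pn.
  by rewrite dm_dx // mz kapp0 => /(_ erefl); rewrite msk_dx_oriented scr0 subr0.
have := mf_boundary_dx hD (representativeP pc pn mz).
have -> : representative psi (msk ori z) = representative psi z.
  by rewrite /representative of_koszul_msk.
rewrite kappB kapp_sc => /mf_boundaryN /(mf_boundaryD H).
by rewrite opprB addrCA subrr addr0.
Qed.

Lemma representative_filtered psi z :
  filtered n ((1 - n%:Z) *+ seifert_circles D) y0 ->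
  forall b, degree_le (representative psi z b)
    ((n%:Z - 1) * (writhe D + (seifert_circles D)%:Z) - qdeg b).
Proof.
move=> fy b.
have f1 : filtered n ((1 - n%:Z) *+ seifert_circles D + (n%:Z - 1) *+ 2 *+ size circles)
    (circle_idem psi *: y0).
  by apply: filteredZ fy; apply: degree_le_prod => k; exact: degree_le_idem.
have := filteredZ (@degree_leC F m ((coordinate fl (to_koszul z)).@[psi])) f1.
move/of_koszul_filtered/(_ b) => H; apply: degree_le_trans H _.
have -> : size circles = seifert_circles D.
  rewrite size_mask ?seifert_circles_closing // size_map.
  by elim: (seifert_edges D) (id : 'I_m -> 'I_m) => [|[j i] l IH] rho //=; rewrite IH.
lia.
Qed.

End Generator.
End ConstantStates.

(** * The bounds *)

Lemma jump_bounds (f : int -> Prop) (lo hi : int) :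
  (forall k, f k -> lo <= k <= hi) -> (exists k, f k) ->
  exists gmin gmax, [/\ f gmin, f gmax & forall k, f k -> gmin <= k <= gmax].
Proof.
move=> bd [k0 fk0].
pose P (j : nat) := `[< f (lo + j%:Z) >].
have toP k : f k -> P `|k - lo|%N.
  move=> fk; apply/asboolP; have /andP[lk _] := bd k fk.
  by rewrite gez0_abs ?subr_ge0 // subrKC.
have exP : exists j, P j by exists `|k0 - lo|%N; exact: toP.
have ubP j : P j -> (j <= `|hi - lo|)%N by move=> /asboolP/bd; lia.
case: (ex_minnP exP) => j0 /asboolP Pj0 minj; case: (ex_maxnP exP ubP) => j1 /asboolP Pj1 maxj.
exists (lo + j0%:Z), (lo + j1%:Z); split=> // k fk.
have /andP[lk _] := bd k fk; have := minj _ (toP k fk); have := maxj _ (toP k fk); lia.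
Qed.

Section Main.
Variables (F : fieldType) (n m : nat) (D : seq (piece m)).
Local Notation A := {mpoly F[m]}.
Local Notation C := (diagram_complex F n D).
Local Notation V := {ffun gens C -> A}.
Local Notation dm := (kapp (@dmf _ C)).
Local Notation dx := (kapp (@dchi _ C)).
Hypothesis n_gt0 : (0 < n)%N.
Hypothesis charF : forall k, k.+1%:R != 0 :> F.
Hypothesis hD : knot_diagram D.
Variable r : seq F.
Hypothesis r_uniq : uniq r.
Hypothesis r_size : size r = n.
Hypothesis r_roots : forall c, c \in r -> c ^+ n = 1.

Definition root_at (i : 'I_n) : F := r`_i.

Lemma root_atP i : root_at i ^+ n = 1.
Proof. by apply/r_roots/mem_nth; rewrite r_size. Qed.

Lemma sc_suml I (s : seq I) (f : I -> A) (z : V) :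
  sc (\sum_(i <- s) f i) z = \sum_(i <- s) sc (f i) z.
Proof.
apply/ffunP => t; rewrite sum_ffunE ffunE mulr_suml.
by apply: eq_bigr => i _; rewrite ffunE.
Qed.

Lemma sum_states (z : V) :
  z = \sum_(psi : {ffun 'I_m -> 'I_n}) sc (state_idem n (fun k => root_at (psi k))) z.
Proof.
rewrite -[LHS]sc1 -sc_suml; congr (sc _ z).
rewrite /state_idem -(bigA_distr_bigA (fun k i => idem n (root_at i) 'X_k)).
rewrite big1 // => k _; rewrite -(sum_idem n_gt0 charF 'X_k r_uniq r_size r_roots).
by rewrite (big_nth 0) r_size big_mkord; exact: eq_bigr.
Qed.

Definition fil_le k (z : V) := forall b, degree_le (z b) (k - qdeg b).

Lemma fil_leP k z : chain_filtration k (z : chain C) <-> fil_le k z.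
Proof.
by split=> H b mon Hmon; have := H b mon Hmon; rewrite lerBrDl.
Qed.

Local Notation Z := (@hp_cycle F n m D).
Local Notation B := (@hp_boundary F n m D).
Local Notation S1 := (homology (apply_mx (@dmf _ C)) (chains F n D)).
Local Notation H := (Hp F n D).

Lemma bdr_homologyP (z : V) : bdr S1 z <-> mf_boundary z.
Proof.
split=> [[w [b [_ -> ->]]]|[w ->]]; first by exists w; rewrite addr0.
by exists w, 0; split; rewrite ?addr0.
Qed.

Lemma cyc_homologyP (z : V) : cyc S1 z <-> dm z = 0.
Proof. by split=> [[_]|dz]. Qed.

Lemma cyc_HpP (z : V) : cyc H z <-> Z z.
Proof.
split=> -[z1 z2]; split.
- exact/cyc_homologyP.
- exact/bdr_homologyP.
- exact/cyc_homologyP.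
- exact/bdr_homologyP.
Qed.

Lemma bdr_HpP (z : V) : bdr H z <-> B z.
Proof.
split=> [[w [b [/cyc_homologyP dw /bdr_homologyP[w' ->] ->]]]|[w [w' [dw ->]]]].
  by exists w, w'.
by exists w, (dm w'); split=> //; apply/bdr_homologyP; exists w'.
Qed.

(** A filtered representative up to the first boundaries differs from the given
    one by an image of the first differential, so one level of representatives
    suffices for the iterated filtration. *)
Lemma fil_HpP k (z : V) : fil H k z <-> Z z /\ exists y : V, [/\ Z y, fil_le k y & B (z - y)].
Proof.
split=> [[/cyc_HpP Zz [y [/cyc_HpP Zy fy /bdr_HpP Bzy]]]|[Zz [y [Zy fy Bzy]]]].
  split=> //; case: fy => [/cyc_homologyP dy [y' [/cyc_homologyP dy' /fil_leP fy' /bdr_homologyP ey]]].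
  exists y'; split=> //.
    split=> //; have [_ dxy] := Zy; have := mf_boundary_dx hD ey.
    rewrite kappB => /mf_boundaryN /(mf_boundaryD dxy); by rewrite opprB addrC subrK.
  rewrite -(subrK y z) -addrA; apply: hp_boundaryD => //; exact: mf_boundary_hp.
split; first exact/cyc_HpP.
exists y; split; [exact/cyc_HpP| |exact/bdr_HpP].
have [dy _] := Zy; split; first exact/cyc_homologyP.
exists y; split; [exact/cyc_homologyP|exact/fil_leP|].
by apply/bdr_homologyP; rewrite subrr; exact: mf_boundary0.
Qed.

Lemma fil_le_trans k k' z : fil_le k z -> k <= k' -> fil_le k' z.
Proof. by move=> fz kk b; apply: degree_le_trans (fz b) _; rewrite lerD2r. Qed.

Local Notation O := (seifert_circles D).
Local Notation lo := ((n%:Z - 1) * (writhe D - O%:Z)).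
Local Notation hi := ((n%:Z - 1) * (writhe D + O%:Z)).

Definition is_constant (psi : {ffun 'I_m -> 'I_n}) :=
  all (fun e => root_at (psi e.1) == root_at (psi e.2)) (flatten (map (@strands m) D)).

Lemma nonconstant_boundary psi z : ~~ is_constant psi -> Z z ->
  B (sc (state_idem n (fun k => root_at (psi k))) z).
Proof.
move=> npsi Zz; apply: (nonconstant_state charF hD) => // k; exact: root_atP.
Qed.

Lemma hp_boundary_sum I (s : seq I) (P : pred I) (f : I -> V) :
  (forall i, P i -> B (f i)) -> B (\sum_(i <- s | P i) f i).
Proof.
move=> Hf; apply: (big_ind B) => //; last exact: hp_boundaryD.
exact/mf_boundary_hp/mf_boundary0.
Qed.

Section WithGenerator.
Variable y0 : koszul F m (size (seifert_edges D)).
Hypothesis dy0 : kd n (fun k => 'X_k) y0 = 0.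
Hypothesis cy0 : coordinate (closing id (seifert_edges D)) y0 = 1.
Hypothesis fy0 : filtered n ((1 - n%:Z) *+ O) y0.

Local Notation rep psi z := (representative y0 (fun k => root_at (psi k)) z).

Lemma constantP psi : is_constant psi -> forall u v, root_at (psi u) = root_at (psi v).
Proof. exact: (knot_constant hD). Qed.

Lemma represented (z : V) : Z z -> exists y : V, [/\ Z y, fil_le hi y & B (z - y)].
Proof.
move=> Zz; have [dz _] := Zz; exists (\sum_(psi | is_constant psi) rep psi z); split.
- split; first by rewrite kapp_sum big1 // => psi _; exact: representative_cycle.
  rewrite kapp_sum; apply: mf_boundary_sum => psi cpsi.
  apply: (representative_dx n_gt0 charF hD dy0 cy0) => //; first exact: constantP.
  by move=> k; exact: root_atP.
- move=> b; rewrite sum_ffunE; apply: degree_le_sum => psi _.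
  exact: representative_filtered.
rewrite {1}[z]sum_states (bigID is_constant) /= addrAC -sumrB.
apply: hp_boundaryD; apply: hp_boundary_sum => psi cpsi; last exact: nonconstant_boundary.
apply/mf_boundary_hp/representativeP => //; first exact: constantP.
by move=> k; exact: root_atP.
Qed.

Lemma low_filtration (z : V) k : Z z -> fil_le k z -> k < lo -> B z.
Proof.
move=> Zz fz klo; have [dz _] := Zz; rewrite [z]sum_states.
apply: hp_boundary_sum => psi _; case: (boolP (is_constant psi)) => cpsi; last exact: nonconstant_boundary.
have := representativeP n_gt0 charF hD dy0 cy0 (constantP cpsi) (fun k => root_atP (psi k)) dz.
have c0 : coordinate (closing id (seifert_edges D)) (to_koszul z) = 0.
  have fK : filtered n (k - (n%:Z - 1) * writhe D) (to_koszul z).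
    by apply: to_koszul_filtered => b; rewrite subrK; exact: fz.
  have sc : size (closing id (seifert_edges D)) = size (seifert_edges D).
    by elim: (seifert_edges D) (id : 'I_m -> 'I_m) => [|[j i] l IH] rho //=; rewrite IH.
  have := filtered_coordinate sc fK; rewrite -seifert_circles_closing // => dc.
  apply/eqP; rewrite -msupp_eq0; case Es: (msupp _) => [|mon s] //.
  have := dc mon; rewrite Es inE eqxx => /(_ isT) Hmon; exfalso.
  move: Hmon klo; clear; set a := (mdeg mon); nia.
by rewrite /representative c0 meval0 mpolyC0 scale0r -(scale0r y0) of_koszulZ sc0 subr0;
  exact: mf_boundary_hp.
Qed.

(** Multiplication by the idempotent e moves a primitive w of the class into the
    oriented resolution, which the second differential leaves; so only the first
    differential contributes, and it vanishes at the constant state. *)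
Lemma nonzero_class : exists z, Z z /\ ~ B z.
Proof.
pose i0 := Ordinal n_gt0; pose c := root_at i0; pose psi (k : 'I_m) := c.
have pc u v : psi u = psi v by [].
have pn k : psi k ^+ n = 1 by exact: root_atP.
pose e := state_idem n psi.
have ec : e.@[psi] = 1.
  rewrite /e /state_idem rmorph_prod /= big1 // => k _.
  by rewrite meval_idem mevalXU lagrange_self.
have dw : dm (of_koszul n y0) = 0.
  by rewrite of_koszul_dmf ?(all_good hD) // dy0 -(scale0r y0) of_koszulZ sc0.
pose z := representative y0 psi (of_koszul n y0).
exists z; split.
  by split; [exact: representative_cycle | exact: (representative_dx n_gt0 charF hD dy0 cy0)].
move=> [w [w' [dw0 Ez]]].
have := congr1 (fun v => to_koszul (sc e v)) Ez; rewrite /= scD -!kapp_sc.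
have [v Hv] := constant_state n_gt0 charF hD pc pn dw0.
have -> : sc e w = sc e (msk (@oriented F n m D) w) + dm v by rewrite -Hv addrC subrK.
rewrite kappD -(dm_dx hD) -addrA -kappD to_koszulD.
have -> : to_koszul (dx (sc e (msk (@oriented F n m D) w))) = 0.
  by rewrite -of_koszul_msk -msk_sc msk_dx_oriented -(sc0 0) to_koszulZ scale0r.
rewrite add0r to_koszul_dmf ?(all_good hD) //.
move/(congr1 (fun y => (coordinate (closing id (seifert_edges D)) y).@[psi])).
rewrite (@coordinate_kd_eval F n m psi _ _ _ _ c (root_atP i0)); last first.
  by move=> k; rewrite mevalXU.
rewrite to_koszulZ coordinateZ mevalM ec mul1r /z /representative !of_koszulK cy0 meval1.
rewrite !coordinateZ cy0 mulr1 mpolyC1 mul1r /circle_idem rmorph_prod /= big1.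
  by move/eqP; rewrite oner_eq0.
by move=> k _; rewrite meval_idem mevalXU lagrange_self.
Qed.

End WithGenerator.

Theorem filtration_bounds : exists gmin gmax : int,
  [/\ is_gmin F n D gmin, is_gmax F n D gmax, lo <= gmin, gmin <= gmax & gmax <= hi].
Proof.
have [y0 [dy0 cy0 fy0]] := generator_exists F n hD.
have upper k z : fil H k z -> fil H hi z.
  by move=> /fil_HpP[Zz _]; apply/fil_HpP; split=> //; exact: (represented dy0 cy0 fy0).
have lower k z : k < lo -> fil H k z -> B z.
  move=> klo /fil_HpP[Zz [y [Zy fy Bzy]]]; rewrite -(subrK y z).
  by apply: hp_boundaryD => //; exact: (low_filtration dy0 cy0 Zy fy).
have mono k k' z : k <= k' -> fil H k z -> fil H k' z.
  move=> kk /fil_HpP[Zz [y [Zy fy Bzy]]]; apply/fil_HpP; split=> //.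
  by exists y; split=> //; exact: fil_le_trans fy kk.
have bounds k : graded_nonzero H k -> lo <= k <= hi.
  move=> [z [fz nfz]]; apply/andP; split; rewrite leNgt; apply/negP => lt; apply: nfz.
    have Bz := lower k z lt fz; have [Zz _] := (fil_HpP k z).1 fz.
    apply/fil_HpP; split=> //; exists 0; rewrite subr0; split=> //.
      by split; rewrite ?kapp0 //; exact: mf_boundary0.
    by move=> b; rewrite ffunE; exact: degree_le0.
  by apply: (mono hi); [lia | exact: upper fz].
have [z [Zz nBz]] := nonzero_class dy0 cy0.
have fz : fil H hi z by apply/fil_HpP; split=> //; exact: (represented dy0 cy0 fy0).
have jump : exists k, graded_nonzero H k.
  case: (EM (exists k, graded_nonzero H k)) => // no.
  have down j : fil H (hi - j%:Z) z.
    elim: j => [|j IH]; first by rewrite subr0.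
    case: (EM (fil H (hi - j.+1%:Z) z)) => // nf; case: no; exists (hi - j%:Z), z; split=> //.
    by rewrite (_ : hi - j%:Z - 1 = hi - j.+1%:Z) //; lia.
  by case: nBz; apply: lower (down (`|hi - lo|%N.+1)); lia.
have [gmin [gmax [fmin fmax all]]] := jump_bounds bounds jump.
exists gmin, gmax; split.
- by split=> // k /all /andP[].
- by split=> // k /all /andP[].
- by have /andP[] := bounds _ fmin.
- by have /andP[] := all _ fmin.
- by have /andP[] := bounds _ fmax.
Qed.

End Main.

Theorem theorem1p3 (R : realType) (n : nat) (hn : (2 <= n)%N)
    (m : nat) (D : seq (piece m)) (hD : knot_diagram D) :
  exists gmin gmax : int,
    [/\ is_gmin (complex R) n D gmin,
        is_gmax (complex R) n D gmax,
        (n%:Z - 1) * (writhe D - (seifert_circles D)%:Z) <= gmin,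
        gmin <= gmax &
        gmax <= (n%:Z - 1) * (writhe D + (seifert_circles D)%:Z)].
Proof.
have n0 : (0 < n)%N by exact: ltnW.
have charC k : k.+1%:R != 0 :> complex R by rewrite pnatr_eq0.
have [r Er] := closed_field_poly_normal ('X^n - 1 : {poly complex R}).
have mon : 'X^n - 1 \is @monic (complex R) by rewrite monicXnsubC.
rewrite (monicP mon) scale1r in Er.
apply: (filtration_bounds n0 charC hD (r := r)).
- rewrite -separable_prod_XsubC -Er; apply: separable_Xn_sub_1.
  by rewrite -(prednK n0).
- have := congr1 (fun q : {poly complex R} => size q) Er.
  by rewrite /= size_prod_XsubC size_XnsubC // => -[].
move=> c cr; apply/eqP; rewrite -subr_eq0.
have : root ('X^n - 1) c by rewrite Er root_prod_XsubC.
by rewrite rootE !hornerE.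
Qed.
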